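(* For every $\delta$ with $0<\delta<1$ there is a constant $\epsilon=\epsilon(\delta)$ with $0<\epsilon<\delta$ such that the following holds. Let $p$ be an odd prime, let $m$ be a positive integer with $m<p^{1-\delta}$, let $k$ be a nonnegative integer and let $b\in \mathbf{F}_p$. Let $N_m^*(k,b)$ be the number of $k$-element subsets $S\subseteq \mathbf{F}_p^*$ such that $\sum_{x\in S}x^m=b$. Then $$\left| N_m^*(k,b)-p^{-1}{p-1 \choose k} \right|\leq {p^{1-\epsilon}+mk-m \choose k}.$$
   Context: $\mathbf{F}_p$ is the field with $p$ elements and $\mathbf{F}_p^*=\mathbf{F}_p\setminus\{0\}$. The empty sum is $0$. For real $x$ and integer $k\ge 0$, $(x)_0=1$, $(x)_k=x(x-1)\cdots(x-k+1)$, and ${x\choose k}=(x)_k/k!$ (so the binomial coefficient is defined for non-integer upper argument). *)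

(* Defs.v *)
From HB Require Import structures.
From mathcomp Require Import all_boot all_order all_algebra.
From mathcomp Require Import all_classical all_reals all_analysis.

Set Implicit Arguments.
Unset Strict Implicit.
Unset Printing Implicit Defensive.

Import Order.TTheory GRing.Theory Num.Theory.

Local Open Scope ring_scope.

Definition falling (R : realType) (x : R) (k : nat) : R :=
  \prod_(i < k) (x - i%:R).

Definition rbinom (R : realType) (x : R) (k : nat) : R :=
  falling x k / k`!%:R.

(* ['F_p] is the field of p elements only for prime p. *)
Definition Nstar (p m k : nat) (b : 'F_p) : nat :=
  #|[set S : {set 'F_p} |
      [&& S \subset [set~ 0], #|S| == k & \sum_(x in S) x ^+ m == b]]|.

(* Main.v *)
(** Expanding the condition [\sum_(x in S) x ^+ m = b] in additive characters,
    p times the number of subsets is a sum over [a] of the k-th elementary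
    symmetric function of the values [e (a x^m)].  The frequency [a = 0] gives
    the main term; for the others Newton's identities turn a bound q for all the
    sums [\sum_x e (a x^m)] into the bound [q (q+1) ... (q+k-1) / k!].

    That one may take q = p^(1-epsilon) is the theorem of Bourgain, Glibichuk and
    Konyagin on Gauss sums.  The set of frequencies where the sum is large is
    invariant under the group H of m-th powers, and by positive definiteness
    many of its differences are large frequencies at a slightly lower level.  By
    pigeonhole some two consecutive levels have comparable sizes, so the
    Balog-Szemeredi-Gowers theorem yields an approximate group V, of essentially
    the size of the spectrum.  A positive proportion of H, up to a dilation,
    maps V into few translates of V.  The elements x such that few translates of V
    cover [x V] are stable under the field operations, and forming
    [(c - d) u + (a - b + c - d) v] squares the size of a set of such elements
    until the quotients of its differences fill F_p.  Hence all dilates of V are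
    covered by few translates of V, which forces V to be tiny or nearly all of
    F_p, against the orbit lower bound and the Parseval upper bound. *)

Require Import Defs.
From HB Require Import structures.
From mathcomp Require Import all_boot all_order all_algebra.
From mathcomp Require Import all_classical all_reals all_analysis.
From mathcomp Require Import complex zify ring lra fintype finset.

Set Implicit Arguments.
Unset Strict Implicit.
Unset Printing Implicit Defensive.

Import Order.TTheory GRing.Theory Num.Theory.

Local Open Scope ring_scope.

(** * Double counting and the Cauchy-Schwarz inequality for finite sums *)

Section Counting.

Lemma card_le_fibers (T U : finType) (Z : {set T}) (X : {set U}) (f : U -> T)
    (n k : nat) :
  (forall z, z \in Z -> n <= k * #|[set u in X | f u == z]|)%N ->
  (#|Z| * n <= k * #|X|)%N.
Proof.
move=> H.
rewrite -sum_nat_const (leq_trans (leq_sum _ H)) // -big_distrr /= leq_mul2l.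
apply/orP; right; rewrite -[#|X|]sum1_card.
rewrite [X in (_ <= X)%N](partition_big f predT) //= [X in (_ <= X)%N](bigID (mem Z)) /=.
apply: leq_trans (leq_addr _ _); apply: leq_sum => z _.
by rewrite -sum1_card; apply/eq_leq/eq_bigl => u; rewrite !inE.
Qed.

Lemma sum_card_swap (T U : finType) (A : {set T}) (B : {set U}) (r : T -> U -> bool) :
  (\sum_(x in A) #|[set y in B | r x y]| = \sum_(y in B) #|[set x in A | r x y]|)%N.
Proof.
transitivity (\sum_(x in A) \sum_(y in B | r x y) 1)%N.
  by apply: eq_bigr => x _; rewrite -sum1_card; apply: eq_bigl => y; rewrite !inE.
rewrite (exchange_big_dep (mem B)) /=; last by move=> x y _ /andP[].
apply: eq_bigr => y yB; rewrite -sum1_card; apply: eq_bigl => x.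
by rewrite !inE yB.
Qed.

Lemma sqr_sumr_le (R : numDomainType) (T : finType) (A : {set T}) (f : T -> R) :
  (forall x, f x \is Num.real) ->
  (\sum_(x in A) f x) ^+ 2 <= #|A|%:R * \sum_(x in A) f x ^+ 2.
Proof.
move=> fR.
have e : (\sum_(x in A) f x) ^+ 2 = \sum_(x in A) \sum_(y in A) f x * f y.
  by rewrite expr2 mulr_suml; apply: eq_bigr => x _; rewrite mulr_sumr.
have e2 : (#|A|%:R * \sum_(x in A) f x ^+ 2) *+ 2
    = \sum_(x in A) \sum_(y in A) (f x ^+ 2 + f y ^+ 2).
  under [RHS]eq_bigr do rewrite big_split /= sumr_const.
  by rewrite big_split /= sumr_const sumrMnl mulr2n mulr_natl.
rewrite -(ler_pMn2r (isT : 0 < 2)%N) e2 e -sumrMnl.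
apply: ler_sum => x _; rewrite -sumrMnl; apply: ler_sum => y _.
by rewrite -subr_ge0 addrAC -sqrrB -realEsqr rpredB.
Qed.

Lemma sqr_sumn_le (T : finType) (A : {set T}) (f : T -> nat) :
  ((\sum_(x in A) f x) ^ 2 <= #|A| * \sum_(x in A) f x ^ 2)%N.
Proof.
rewrite -(ler_nat int) natrX natrM !natr_sum.
under [X in _ <= _ * X]eq_bigr do rewrite natrX.
by apply: sqr_sumr_le => x; rewrite realn.
Qed.

End Counting.

(** * Sumsets *)

Section Sumsets.
Variable G : finZmodType.
Implicit Types A B W X Y : {set G}.

Definition sumset A B : {set G} := [set x + y | x in A, y in B].
Definition oppset A : {set G} := [set - x | x in A].
(** The autocorrelation of the indicator function of [A]. Its maximum is |A|, attained at 0, so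
    popularity is measured relative to |A|. *)
Definition nrep A (x : G) : nat := #|[set a in A | a - x \in A]|.
Definition popular_diffs A (k : nat) : {set G} := [set x | #|A| <= k * nrep A x]%N.

Lemma sumsetP A B z :
  reflect (exists x y, [/\ x \in A, y \in B & z = x + y]) (z \in sumset A B).
Proof.
apply: (iffP imset2P) => [[x y Ax By ->]|[x [y [Ax By ->]]]]; first by exists x, y.
by exists x y.
Qed.

Lemma mem_sumset A B x y : x \in A -> y \in B -> x + y \in sumset A B.
Proof. by move=> Ax By; apply/sumsetP; exists x, y. Qed.

Lemma mem_oppset A x : (x \in oppset A) = (- x \in A).
Proof.
apply/imsetP/idP => [[y Ay ->]|Ax]; first by rewrite opprK.
by exists (- x); rewrite ?opprK.
Qed.

Lemma nrep_opp A x : nrep A (- x) = nrep A x.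
Proof.
rewrite /nrep -(card_imset (mem [set a in A | a - x \in A]) (addIr (- x))).
apply: eq_card => y; rewrite inE opprK; apply/andP/imsetP => [[Ay Ayx]|[a]].
  by exists (y + x); rewrite ?inE ?addrK // Ayx.
by rewrite inE => /andP[Aa Aax] ->; rewrite subrK.
Qed.

Lemma popular_diffs_opp A k x : (- x \in popular_diffs A k) = (x \in popular_diffs A k).
Proof. by rewrite !inE nrep_opp. Qed.

(* Writing [s = a - (a - s)] in every possible way turns one representation of
   [x + s + y] into many pairs of [X - A] and [A + Y]. *)
Lemma card_sumset_popular A X Y k :
  (#|sumset X (sumset (popular_diffs A k) Y)| * #|A|
   <= k * (#|sumset X (oppset A)| * #|sumset A Y|))%N.
Proof.
rewrite -[X in (_ <= _ * X)%N]cardsX.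
apply: (@card_le_fibers _ _ _ _ (fun u : G * G => u.1 + u.2)) => z.
case/sumsetP=> x [_ [Xx /sumsetP[s [y [Ss Yy ->]]] ->]].
move: Ss; rewrite inE => /leq_trans; apply.
rewrite leq_mul2l; apply/orP; right.
have inj : injective (fun a : G => (x - (a - s), a + y)).
  by move=> a b [_ /addIr].
rewrite /nrep -(card_imset _ inj).
apply/subset_leq_card/subsetP => _ /imsetP[a + ->].
rewrite !inE /= => /andP[Aa Aas]; rewrite !mem_sumset ?mem_oppset ?opprK //=.
by apply/eqP; rewrite opprB -!addrA; congr (_ + (_ + _)); rewrite addrCA addNKr.
Qed.

Lemma sum_nrep A : (\sum_(x in sumset A (oppset A)) nrep A x = #|A| ^ 2)%N.
Proof.
rewrite -mulnn -cardsX -[RHS]sum1_card.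
rewrite (partition_big (fun u : G * G => u.1 - u.2) (mem (sumset A (oppset A)))) /=; last first.
  by move=> [a b] /setXP[Aa Ab]; rewrite mem_sumset ?mem_oppset ?opprK.
apply: eq_bigr => x _; rewrite sum1dep_card /nrep.
have inj : injective (fun a : G => (a, a - x)) by move=> a b [].
rewrite -(card_imset _ inj); apply: eq_card => -[a b]; rewrite !inE /=.
apply/imsetP/andP => [[c]|[/andP[Aa Ab] /eqP <-]].
  by rewrite inE => /andP[Ac Acx] [-> ->]; rewrite Ac Acx subKr.
by exists a; rewrite ?inE ?Aa subKr.
Qed.

(** Distribute the |A|^2 pairs over the differences. Unpopular differences carry at most |A|/(2K)
    pairs each, hence at most half of all pairs; a popular one carries at most |A|, so the other
    half needs |A|/2 of them. *)
Lemma card_popular_diffs A K :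
  (0 < K)%N -> (#|sumset A (oppset A)| <= K * #|A|)%N ->
  (#|A| <= 2 * #|popular_diffs A (2 * K)|)%N.
Proof.
move=> K0 doubling; have [->//|A0] := posnP #|A|.
set S := popular_diffs _ _; set D := sumset _ _ in doubling.
have main : (2 * K * #|A| ^ 2 <= 2 * K * (#|S| * #|A|) + #|D| * #|A|)%N.
  rewrite -sum_nrep -/D (bigID (mem S)) /= mulnDr; apply: leq_add.
    rewrite leq_mul2l; apply/orP; right.
    apply: leq_trans (_ : \sum_(i in D | i \in S) #|A| <= _)%N.
      by apply: leq_sum => x _; rewrite /nrep subset_leq_card //; apply/subsetP => y; rewrite inE => /andP[].
    rewrite sum_nat_const leq_mul2r; apply/orP; right.
    by apply/subset_leq_card/subsetP => x /andP[].
  rewrite big_distrr /=.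
  apply: leq_trans (_ : \sum_(i in D | i \notin S) #|A| <= _)%N.
    by apply: leq_sum => x /andP[_]; rewrite inE -ltnNge => /ltnW.
  rewrite sum_nat_const leq_mul2r; apply/orP; right.
  by apply/subset_leq_card/subsetP => x /andP[].
by nia.
Qed.

Fixpoint iter_sumset S Y n := if n is n'.+1 then sumset S (iter_sumset S Y n') else Y.

(** By [card_sumset_popular] with X = A, each further summand of popular differences costs a factor
    2K for popularity and a factor K for the size of A - A. *)
Lemma card_iter_sumset A K n : (0 < #|A|)%N ->
  (#|sumset A (oppset A)| <= K * #|A|)%N ->
  (#|sumset A (iter_sumset (popular_diffs A (2 * K)) (oppset A) n)|
   <= (2 * K ^ 2) ^ n * K * #|A|)%N.
Proof.
move=> A0 doubling; elim: n => [|n IH]; first by rewrite expn0 mul1n.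
have := card_sumset_popular A A (iter_sumset (popular_diffs A (2 * K)) (oppset A) n) (2 * K) => step.
rewrite -(leq_pmul2r A0); apply: leq_trans step _.
have : (#|sumset A (oppset A)| * #|sumset A (iter_sumset (popular_diffs A (2 * K)) (oppset A) n)|
  <= (K * #|A|) * ((2 * K ^ 2) ^ n * K * #|A|))%N by apply: leq_mul.
rewrite -(leq_pmul2l (_ : 0 < 2 * K.+1)%N) //= => h.
rewrite expnS; move: h; set u := ((_ ^ n)%N); set c := #|_|; set d := #|_|; nia.
Qed.

(** Take a maximal family of disjoint translates of [W] with base points in [X]. It has at most [k]
    members, and by maximality every x + W meets one of them. *)
Lemma ruzsa_covering X W k : (0 < #|W|)%N -> (#|sumset X W| <= k * #|W|)%N ->
  exists2 T : {set G}, (#|T| <= k)%N &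
    forall x, x \in X -> exists t w w',
      [/\ t \in T, w \in W, w' \in W & x = t + w - w'].
Proof.
move=> W0 leXW.
(* The equation of cardinalities says that the translates t + W, t in [T], are pairwise disjoint. *)
pose P (T : {set G}) := (T \subset X) && (#|sumset T W| == #|T| * #|W|)%N.
have P0 : P set0.
  rewrite /P sub0set cards0 mul0n cards_eq0 -subset0; apply/subsetP => z.
  by case/sumsetP=> x [y []]; rewrite inE.
have [T maxT] := ex_maxset (ex_intro P _ P0).
case/maxsetP: maxT => /andP[TX /eqP cT] maxT.
exists T.
  rewrite -(leq_pmul2r W0) -cT (leq_trans _ leXW) //.
  apply/subset_leq_card/subsetP => _ /sumsetP[x [y [Tx Wy ->]]].
  by rewrite mem_sumset // (subsetP TX).
move=> x Xx.
have [w0 Ww0] : exists w, w \in W by apply/set0Pn; rewrite -card_gt0.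
have [Tx|Tx] := boolP (x \in T); first by exists x, w0, w0; rewrite addrK.
have [/eqP I0|/set0Pn[z]] := boolP ([set x + w | w in W] :&: sumset T W == set0).
  have : P (x |: T).
    rewrite /P subUset sub1set Xx TX /= cardsU1 Tx mulnDl mul1n -cT.
    have -> : sumset (x |: T) W = [set x + w | w in W] :|: sumset T W.
      apply/setP => z; apply/sumsetP/setUP => [[y [w [+ Ww ->]]]|[/imsetP[w Ww ->]|]].
      - by case/setU1P=> [->|Ty]; [left; apply: imset_f | right; apply: mem_sumset].
      - by exists x, w; rewrite setU11.
      - by case/sumsetP=> t [w [Tt Ww ->]]; exists t, w; rewrite setU1r.
    by rewrite cardsU I0 cards0 subn0 card_imset //; apply: addrI.
  by move=> /maxT/(_ (subsetUr _ _)) eT; rewrite -eT setU11 in Tx.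
case/setIP=> /imsetP[w Ww ->] /sumsetP[t [w' [Tt Ww' e]]].
by exists t, w', w; rewrite -e addrK.
Qed.
End Sumsets.

(** * The Balog-Szemeredi-Gowers theorem *)

Section BSG.
Variable G : finZmodType.
Implicit Types A B L : {set G}.

Definition diff_nbhd L L' (v : G) : {set G} := [set x in L | x - v \in L'].

(* Dependent random choice: for a typical [v], almost all pairs in the
   neighbourhood [nb v] have many common neighbours, so that their differences
   are popular differences of [L']. *)
Lemma balog_szemeredi_gowers (L L' : {set G}) (K : nat) :
  (0 < #|L|)%N -> (#|L'| <= K * #|L|)%N ->
  (#|L| ^ 2 <= K * \sum_(v in L) #|diff_nbhd L L' v|)%N ->
  exists A : {set G}, [/\ A \subset L, (#|L| ^ 2 <= 8 * K ^ 2 * #|A| ^ 2)%N &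
    (#|sumset A (oppset A)| <= 2 ^ 13 * K ^ 10 * #|A|)%N].
Proof.
set N := #|L| => N0 leL' dense.
pose nb := diff_nbhd L L'.
(* [codeg] counts common neighbours, and a pair is bad if it has fewer than N/(32 K^2). Such a pair
   lies in few neighbourhoods, so an average neighbourhood contains few bad pairs. *)
pose codeg x y := #|[set v in L | (x - v \in L') && (y - v \in L')]|.
pose bad x y := (32 * K ^ 2 * codeg x y < N)%N.
pose badp v := [set u in setX L L | [&& u.1 \in nb v, u.2 \in nb v & bad u.1 u.2]].
have sum_nb : (N ^ 3 <= K ^ 2 * \sum_(v in L) #|nb v| ^ 2)%N.
  have cs := sqr_sumn_le L (fun v => #|nb v|).
  rewrite -/N in cs; rewrite -(leq_pmul2l N0) mulnCA.
  apply: leq_trans (_ : K ^ 2 * (\sum_(v in L) #|nb v|) ^ 2 <= _)%N; last by rewrite leq_mul2l cs orbT.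
  rewrite -expnMn -expnS (_ : (N ^ 4 = (N ^ 2) ^ 2)%N) ?leq_sqr //.
  by rewrite -expnM.
have sum_bad : (32 * K ^ 2 * \sum_(v in L) #|badp v| <= N ^ 3)%N.
  rewrite /badp (sum_card_swap L (setX L L)
    (fun v u => [&& u.1 \in nb v, u.2 \in nb v & bad u.1 u.2])) big_distrr /=.
  apply: leq_trans (_ : \sum_(u in setX L L) N <= _)%N; last first.
    by rewrite sum_nat_const cardsX -/N; apply/eq_leq; lia.
  apply: leq_sum => -[x y] _ /=; have [b|nb'] := boolP (bad x y).
    apply: leq_trans (ltnW b); rewrite leq_mul2l; apply/orP; right.
    apply/subset_leq_card/subsetP => v; rewrite !inE.
    by move=> /and3P[-> /andP[_ ->] /andP[/andP[_ ->]]].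
  rewrite (_ : [set _ in _ | _] = set0) ?cards0 ?muln0 //.
  by apply/setP => v; rewrite !inE !andbF.
(* Averaging over [v]: the right-hand sides sum to at least 2 N^3 by [sum_nb], the left-hand sides
   to at most 2 N^3 by [sum_bad]. *)
have [v vL goodv] : exists2 v, v \in L & (32 * K ^ 2 * #|badp v| + N ^ 2 <= 2 * K ^ 2 * #|nb v| ^ 2)%N.
  apply/exists_inP; apply: contraT; rewrite negb_exists_in => /forall_inP none; exfalso.
  have : (\sum_(v in L) (2 * K ^ 2 * #|nb v| ^ 2 + 1)
      <= \sum_(v in L) (32 * K ^ 2 * #|badp v| + N ^ 2))%N.
    by apply: leq_sum => v /none; rewrite -ltnNge addn1.
  rewrite !big_split /= -!big_distrr /= !sum_nat_const -/N; move: sum_nb sum_bad.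
  rewrite !expnS !expn0 !muln1.
  move: (\sum_(v in L) #|nb v| ^ 2)%N (\sum_(v in L) #|badp v|)%N => X Y.
  move: (K * K)%N (N * (N * N))%N => k2 n3; nia.
have Bsq : (N ^ 2 <= 2 * K ^ 2 * #|nb v| ^ 2)%N by apply: leq_trans goodv; apply: leq_addl.
have fewbad : (16 * #|badp v| <= #|nb v| ^ 2)%N.
  have K0 : (0 < K)%N by move: Bsq N0; case: (K) => //; lia.
  have : (0 < K ^ 2)%N by rewrite expn_gt0 K0.
  move=> k2; rewrite -(leq_pmul2l k2) -(leq_pmul2l (isT : 0 < 2)%N).
  lia.
set B := nb v in Bsq fewbad goodv.
have B0 : (0 < #|B|)%N by move: Bsq; case: #|B| N0 => //; lia.
(* At most 1/16 of the pairs of [B] are bad, so by Markov's inequality all but a quarter of [B]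
   survives in [A]. *)
pose A := [set x in B | 4 * #|[set y in B | bad x y]| <= #|B|]%N.
have BA : (4 * #|B :\: A| <= #|B|)%N.
  have e : (#|badp v| = \sum_(x in B) #|[set y in B | bad x y]|)%N.
    rewrite -sum1_card (eq_bigl (fun u => (u.1 \in B) && ((u.2 \in B) && bad u.1 u.2))).
      rewrite -(pair_big_dep (mem B) (fun x y => (y \in B) && bad x y) (fun _ _ => 1%N)) /=.
      by apply: eq_bigr => x _; rewrite sum1dep_card.
    move=> [x y]; rewrite !inE /=.
    by case: (x \in L); case: (y \in L); rewrite ?andbF.
  have : (#|B :\: A| * #|B| <= 4 * #|badp v|)%N.
    rewrite e -sum_nat_const big_distrr /= [X in (_ <= X)%N](bigID (mem A)) /=.
    apply: leq_trans (leq_addl _ _).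
    rewrite (eq_bigl (fun x => (x \in B) && (x \notin A))); last by move=> x; rewrite in_setD andbC.
    by apply: leq_sum => x /andP[xB]; rewrite inE xB /= -ltnNge => /ltnW.
  move=> h; rewrite -(leq_pmul2r B0); lia.
have AB : A \subset B by apply/subsetP => x; rewrite inE => /andP[].
have cA : (#|B| <= 2 * #|A|)%N.
  have := cardsID A B; rewrite (setIidPr AB); lia.
pose D := [set z | N <= 32 * K ^ 2 * #|[set u in setX L' L' | (u.1 - u.2 == z)%R]|]%N.
have cD : (#|D| <= 32 * K ^ 4 * N)%N.
  have : (#|D| * N <= 32 * K ^ 2 * #|setX L' L'|)%N.
    by apply: (@card_le_fibers _ _ _ _ (fun u : G * G => u.1 - u.2)) => z; rewrite inE.
  rewrite cardsX => h; rewrite -(leq_pmul2r N0).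
  have := leq_mul leL' leL'; rewrite -(leq_pmul2l (_ : 0 < 32 * K ^ 2)%N).
    by move=> /(leq_trans h)/leq_trans; apply; apply/eq_leq; lia.
  by rewrite muln_gt0 expn_gt0; move: Bsq N0; case: (K) => //; lia.
have goodD x y : ~~ bad x y -> x - y \in D.
  rewrite /bad -leqNgt inE => /leq_trans; apply; rewrite leq_mul2l; apply/orP; right.
  have inj : injective (fun v => (x - v, y - v)) by move=> u w [/addrI/oppr_inj].
  rewrite /codeg -(card_imset _ inj); apply/subset_leq_card/subsetP => _ /imsetP[u + ->].
  rewrite !inE /= => /and3P[_ -> ->] /=; apply/eqP.
  by rewrite opprB addrA subrK.
(* For x, y in [A], at least half of the w in [B] form good pairs with both, and x - y = (x - w) -
   (y - w) has both terms in [D]. *)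
have AA : (#|sumset A (oppset A)| * #|B| <= 2 * #|setX D D|)%N.
  apply: (@card_le_fibers _ _ _ _ (fun u : G * G => u.1 - u.2)) => z.
  case/sumsetP=> x [y' [Ax]]; rewrite mem_oppset => Ay ->.
  move: Ay; rewrite -[in x + _](opprK y'); move: (- y') => y Ay.
  pose C x := [set w in B | bad x w].
  have cC u : u \in A -> (4 * #|C u| <= #|B|)%N by rewrite inE => /andP[].
  have : (#|B| <= 2 * #|B :\: (C x :|: C y)|)%N.
    have := cardsD B (C x :|: C y).
    have : (#|B :&: (C x :|: C y)| <= #|C x| + #|C y|)%N.
      by apply: leq_trans (subset_leq_card (subsetIr _ _)) _; rewrite cardsU leq_subr.
    have := cC x Ax; have := cC y Ay; lia.
  move=> /leq_trans; apply; rewrite leq_mul2l /=.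
  have inj : injective (fun w => (x - w, y - w)) by move=> u w [/addrI/oppr_inj].
  rewrite -(card_imset _ inj); apply/subset_leq_card/subsetP => _ /imsetP[u + ->].
  rewrite !inE /= negb_or => /andP[/andP[+ +] /andP[uL uv]].
  rewrite ?uL ?uv /= ?andbT => /goodD + /goodD; rewrite !inE => -> -> /=.
  by rewrite opprB addrA subrK.
exists A; split.
- by apply: subset_trans AB _; apply/subsetP => x; rewrite inE => /andP[].
- apply: (leq_trans Bsq); have : (#|B| ^ 2 <= (2 * #|A|) ^ 2)%N by rewrite leq_sqr.
  by rewrite expnMn; nia.
have D2 : (#|D| ^ 2 <= 32 * 32 * 2 * K ^ 10 * #|B| ^ 2)%N.
  have h := leq_mul (leqnn (32 * 32 * K ^ 8)%N) Bsq.
  apply: leq_trans (_ : 32 * 32 * K ^ 8 * N ^ 2 <= _)%N; last first.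
    by apply: leq_trans h _; rewrite (_ : K ^ 10 = K ^ 8 * K ^ 2)%N -?expnD //; apply/eq_leq; ring.
  apply: (@leq_trans ((32 * K ^ 4 * N) ^ 2)%N); first by rewrite leq_sqr.
  by rewrite (_ : K ^ 8 = K ^ 4 * K ^ 4)%N -?expnD //; apply/eq_leq; ring.
rewrite -(leq_pmul2r B0) (leq_trans AA) // cardsX.
apply: (@leq_trans (2 * (32 * 32 * 2 * K ^ 10 * #|B| ^ 2))%N).
  by rewrite mulnn leq_mul2l D2.
have e : (2 ^ 13 = 32 * 32 * 4 * 2)%N by [].
rewrite e; apply: (@leq_trans (32 * 32 * 4 * K ^ 10 * #|B| * #|B|)%N).
  by apply/eq_leq; ring.
apply: leq_trans (leq_mul (leqnn _) cA) _; apply/eq_leq; ring.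
Qed.
End BSG.

(** * Dilates covered by few translates *)

Section Coverings.
Variable F : finFieldType.
Implicit Types (V W T : {set F}) (x y : F).

(** For an approximate group [V], the elements [x] with [k] bounded behave like a subfield: the
    lemmas below give closure under the field operations, at the price of a larger [k]. *)
Definition covers V x (k : nat) :=
  exists2 T : {set F}, (#|T| <= k)%N & forall v, v \in V -> exists2 t, t \in T & x * v - t \in V.

Definition approx_group V (k : nat) :=
  [/\ (0 < #|V|)%N, forall v, v \in V -> - v \in V &
   exists2 T : {set F}, (#|T| <= k)%N &
    forall u v, u \in V -> v \in V -> exists2 t, t \in T & u + v - t \in V].

Lemma card_sumset_le (G : finZmodType) (A B : {set G}) :
  (#|sumset A B| <= #|A| * #|B|)%N.
Proof.
rewrite -cardsX /sumset curry_imset2X; exact: leq_imset_card.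
Qed.

Lemma coversW V x k l : (k <= l)%N -> covers V x k -> covers V x l.
Proof. by move=> kl [T cT covT]; exists T => //; apply: leq_trans kl. Qed.

Lemma approx_group_gt0 V k : approx_group V k -> (0 < k)%N.
Proof.
case=> /card_gt0P[v Vv] _ [T cT covT]; have [t Tt _] := covT v v Vv Vv.
by apply: leq_trans cT; apply/card_gt0P; exists t.
Qed.

Lemma covers_gt0 V x k : (0 < #|V|)%N -> covers V x k -> (0 < k)%N.
Proof.
move=> /card_gt0P[v Vv] [T cT covT]; have [t Tt _] := covT v Vv.
by apply: leq_trans cT; apply/card_gt0P; exists t.
Qed.

Lemma coversD V k0 x y k l : approx_group V k0 ->
  covers V x k -> covers V y l -> covers V (x + y) (k * l * k0)%N.
Proof.
move=> [_ _ [T0 cT0 covT0]] [T cT covT] [T' cT' covT'].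
exists (sumset (sumset T T') T0).
  apply: leq_trans (card_sumset_le _ _) (leq_mul _ cT0).
  exact: leq_trans (card_sumset_le _ _) (leq_mul _ _).
move=> v Vv; have [t Tt vt] := covT v Vv; have [t' Tt' vt'] := covT' v Vv.
have [t0 Tt0 h] := covT0 _ _ vt vt'.
exists (t + t' + t0); first by rewrite !mem_sumset.
by rewrite (_ : _ - _ = x * v - t + (y * v - t') - t0) //; ring.
Qed.

Lemma coversM V x y k l :
  covers V x k -> covers V y l -> covers V (x * y) (k * l)%N.
Proof.
move=> [T cT covT] [T' cT' covT'].
exists (sumset T [set x * t | t in T']).
  by apply: leq_trans (card_sumset_le _ _) (leq_mul _ (leq_trans (leq_imset_card _ _) _)).
move=> v Vv; have [t' Tt' vt'] := covT' v Vv; have [t Tt vt] := covT _ vt'.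
exists (t + x * t'); first by rewrite mem_sumset // imset_f.
by rewrite (_ : _ - _ = x * (y * v - t') - t) //; ring.
Qed.

Lemma coversN V k0 x k : approx_group V k0 -> covers V x k -> covers V (- x) k.
Proof.
move=> [_ Vopp _] [T cT covT]; exists (oppset T).
  exact: leq_trans (leq_imset_card _ _) cT.
move=> v Vv; have [t Tt vt] := covT v Vv.
exists (- t); first by rewrite mem_oppset opprK.
by rewrite (_ : _ - _ = - (x * v - t)) ?Vopp //; ring.
Qed.

(** Pigeonhole: one of the translates covering x V receives a share 1/k of it. *)
Lemma covers_dense V x k : (0 < #|V|)%N -> covers V x k ->
  exists t, (#|V| <= k * #|[set v in V | (x * v - t)%R \in V]|)%N.
Proof.
move=> V0 covV; have k0 := covers_gt0 V0 covV; case: covV => T cT covT.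
apply/existsP; apply: contraT; rewrite negb_exists => /forallP none; exfalso.
pose c t := #|[set v in V | (x * v - t)%R \in V]|.
have V_le : (#|V| <= \sum_(t in T) c t)%N.
  rewrite /c (sum_card_swap T V (fun t v => x * v - t \in V)) -sum1_card.
  apply: leq_sum => v Vv; have [t Tt vt] := covT v Vv.
  by apply/card_gt0P; exists t; rewrite inE Tt.
have : (\sum_(t in T) (k * c t + 1) <= \sum_(t in T) #|V|)%N.
  by apply: leq_sum => t _; rewrite addn1 ltnNge none.
have T0 : (0 < #|T|)%N.
  case/card_gt0P: V0 => v /covT[t Tt _]; by apply/card_gt0P; exists t.
rewrite big_split /= -big_distrr /= !sum_nat_const.
move: V_le cT T0 k0; move: (\sum_(t in T) c t)%N #|T| #|V| => *; nia.
Qed.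

Lemma card_sumset_approx V k : approx_group V k -> (#|sumset V V| <= k * #|V|)%N.
Proof.
move=> [_ _ [T cT covT]].
apply: leq_trans (_ : #|sumset T V| <= _)%N; last first.
  by apply: leq_trans (card_sumset_le _ _) _; rewrite leq_mul2r cT orbT.
apply/subset_leq_card/subsetP => _ /sumsetP[u [v [Vu Vv ->]]].
by have [t Tt h] := covT u v Vu Vv; rewrite -(subrK t (u + v)) addrC mem_sumset.
Qed.

(** By [covers_dense], a dense part [W] of [V] has x W inside a translate of [V], so V + x W is
    small. Ruzsa covering puts [V] into few translates of x W - x W; dividing by [x] leaves W - W,
    which lies in V + V. *)
Lemma coversV V k0 x k : approx_group V k0 -> x != 0 ->
  covers V x k -> covers V x^-1 (k0 * k * k0)%N.
Proof.
move=> apV x0 covx; have VV := card_sumset_approx apV.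
case: apV => V0 Vopp [T0 cT0 covT0]; have [t ct] := covers_dense V0 covx.
set W := [set v in V | _] in ct.
have xI : injective ( *%R x) by apply: mulfI.
have cxW : #|[set (x * w)%R | w in W]| = #|W| by apply: card_imset.
have W0 : (0 < #|[set (x * w)%R | w in W]|)%N.
  by rewrite cxW; move: V0 ct; case: #|W| => //; rewrite muln0; case: #|V|.
have [|T cT covT] := @ruzsa_covering _ V _ (k0 * k)%N W0.
  rewrite cxW -mulnA; apply: leq_trans (leq_mul (leqnn k0) ct); apply: leq_trans VV.
  rewrite -(card_imset (mem (sumset V V)) (addIr t)).
  apply/subset_leq_card/subsetP => _ /sumsetP[u [_ [Vu /imsetP[w + ->] ->]]].
  rewrite inE => /andP[_ h]; apply/imsetP; exists (u + (x * w - t)).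
    exact: mem_sumset.
  by rewrite -addrA subrK.
exists (sumset [set x^-1 * t | t in T] T0).
  by apply: leq_trans (card_sumset_le _ _) (leq_mul (leq_trans (leq_imset_card _ _) _) _).
move=> v /covT[t1 [_ [_ [Tt1 /imsetP[w Ww ->] /imsetP[w' Ww' ->] ->]]]].
move: Ww Ww'; rewrite !inE => /andP[Vw _] /andP[/Vopp Vw' _].
have [t0 Tt0 h] := covT0 _ _ Vw Vw'.
exists (x^-1 * t1 + t0); first by rewrite mem_sumset // imset_f.
by rewrite (_ : _ - _ = w + - w' - t0) //; field.
Qed.

(** Every nonzero [x] is a quotient of two nonzero elements of V + V in at least |V|/(2k) ways, so
    (|F| - 1) |V| is at most 2k |V + V|^2. *)
Lemma card_le_of_covers V k0 k : approx_group V k0 -> (forall x, covers V x k) ->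
  (#|F| <= (2 * k * k0 ^ 2).+1 * #|V|)%N \/ (#|V| < 2 * k)%N.
Proof.
move=> apV cov; have VV := card_sumset_approx apV.
case: apV => V0 Vopp _; have [Vk|] := ltnP #|V| (2 * k); [by right | move=> Vk; left].
pose VV0 := sumset V V :\ 0.
have pairs x : x \in [set~ 0] ->
    (#|V| <= 2 * k * #|[set u in setX VV0 VV0 | (u.2 / u.1)%R == x]|)%N.
  rewrite !inE => x0; have [t ct] := covers_dense V0 (cov x).
  set W := [set v in V | _] in ct.
  (* Two elements in [W] ensure that removing the base point [w0] costs at most half of [W]; this is
     where |V| >= 2k enters. *)
  have W2 : (2 <= #|W|)%N by move: Vk ct (covers_gt0 V0 (cov x)); nia.
  have [w0 Ww0] : exists w, w \in W by apply/card_gt0P; apply: ltnW.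
  apply: leq_trans (_ : 2 * k * #|W :\ w0| <= _)%N.
    by have := cardsD1 w0 W; rewrite Ww0; move: ct W2; nia.
  rewrite leq_mul2l; apply/orP; right.
  have inj : injective (fun w => (w - w0, x * (w - w0))) by move=> u w [/addIr].
  rewrite -(card_imset _ inj); apply/subset_leq_card/subsetP => _ /imsetP[w + ->].
  move: Ww0; rewrite !inE /= => /andP[Vw0 xw0] /and3P[ww0 Vw xw].
  have d0 : w - w0 != 0 by rewrite subr_eq0.
  rewrite mulf_neq0 // d0 mulfK // eqxx andbT /= mem_sumset ?Vopp //=.
  by rewrite (_ : x * _ = x * w - t + - (x * w0 - t)) ?mem_sumset ?Vopp //; ring.
have := card_le_fibers pairs; rewrite cardsX cardsC1.
have : (#|VV0| <= #|sumset V V|)%N by apply/subset_leq_card/subD1set.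
move: VV; rewrite -mulnn; have F0 : (0 < #|F|)%N by apply/card_gt0P; exists 0.
move: #|VV0| #|sumset V V| #|V| #|F| V0 F0 => a b v f v0 f0 bv ab h.
have ak : (a <= k0 * v)%N by lia.
have aa : (a * a <= (k0 * v) * (k0 * v))%N by apply: leq_mul.
have : (f.-1 * v <= 2 * k * ((k0 * v) * (k0 * v)))%N.
  by apply: leq_trans h _; rewrite leq_mul2l aa orbT.
move=> h2; have : (f.-1 <= 2 * k * (k0 * k0) * v)%N.
  by rewrite -(leq_pmul2r v0); apply: leq_trans h2 _; apply/eq_leq; ring.
move: (2 * k * (k0 * k0))%N => c; nia.
Qed.

End Coverings.

(** * Growth of sets of dilation factors in a prime field *)

Section PrimeField.
Variable p : nat.
Hypothesis p_pr : prime p.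
Implicit Types (V B : {set 'F_p}).

(* If some quotient of differences [q] has [q + 1] not of this form, the
   dilates of [B] by the denominator and by [q + 1] times it add up without
   collisions; in a prime field such a [q] exists unless all elements are
   quotients. *)
Lemma quotients_or_growth B : (1 < #|B|)%N ->
  (forall x : 'F_p, exists a b c d, [/\ [&& a \in B, b \in B, c \in B & d \in B], c != d
     & x = (a - b) / (c - d)]) \/
  (exists a b c d, [/\ [&& a \in B, b \in B, c \in B & d \in B], c != d &
    {in setX B B &, injective (fun u : 'F_p * 'F_p => (c - d) * u.1 + (a - b + (c - d)) * u.2)}]).
Proof.
move=> /card_gt1P[b0 [b1 [Bb0 Bb1 b01]]].
pose isQ (x : 'F_p) := [exists u : ('F_p * 'F_p) * ('F_p * 'F_p),
  [&& u.1.1 \in B, u.1.2 \in B, u.2.1 \in B & u.2.2 \in B] && (u.2.1 != u.2.2)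
  && (x == (u.1.1 - u.1.2) / (u.2.1 - u.2.2))].
have isQP x : reflect (exists a b c d, [/\ [&& a \in B, b \in B, c \in B & d \in B], c != d
     & x = (a - b) / (c - d)]) (isQ x).
  apply: (iffP existsP) => [[[[a b] [c d]] /= /andP[/andP[h cd] /eqP ->]]|].
    by exists a, b, c, d.
  by case=> a [b [c [d [h cd ->]]]]; exists ((a, b), (c, d)); rewrite /= h cd eqxx.
(* The quotients contain 0; if they are closed under adding 1 they exhaust the prime field. *)
have [/forallP all|] := boolP [forall x, isQ x ==> isQ (x + 1)].
  left=> x; apply/isQP; rewrite -(natr_Zp x); elim: (val x) => [|n IH].
    by apply/isQP; exists b0, b0, b0, b1; rewrite Bb0 Bb1 subrr mul0r.
  by rewrite -natr1; apply: (implyP (all _)).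
rewrite negb_forall => /existsP[q]; rewrite negb_imply => /andP[/isQP[a [b [c [d [h cd eq]]]]] nQ].
right; exists a, b, c, d; split=> // -[u v] [u' v'] /setXP[/= Bu Bv] /setXP[/= Bu' Bv'] e.
have cd0 : c - d != 0 by rewrite subr_eq0.
have [vv|vv] := eqVneq v v'.
  by move: e; rewrite vv => /addIr/(mulfI cd0) ->.
(* A collision with v different from v' would give q + 1 = (u' - u) / (v - v'). *)
case/isQP: nQ; exists u', u, v, v'; rewrite Bu Bv Bu' Bv'; split=> //.
have vv0 : v - v' != 0 by rewrite subr_eq0.
apply: (mulIf vv0); rewrite divfK //; apply: (mulfI cd0).
have eqq : (c - d) * q = a - b by rewrite eq mulrC divfK.
rewrite (_ : _ * (_ * _) = ((c - d) * q + (c - d)) * (v - v')); last by ring.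
rewrite eqq; apply/eqP; rewrite -subr_eq0.
by move/eqP: e; rewrite -subr_eq0 => /eqP <-; apply/eqP; rewrite /=; ring.
Qed.

(* The exponent 13 bounds the cost of one growth step, i.e. of covering
   [(c - d) * u + (a - b + (c - d)) * v]. *)
Lemma covers_all V k0 L B k : approx_group V k0 -> (k0 <= k)%N -> (1 < #|B|)%N ->
  (p < #|B| ^ (2 ^ L))%N -> (forall x, x \in B -> covers V x k) ->
  forall x, covers V x (k ^ (13 ^ L))%N.
Proof.
move=> apV; elim: L B k => [|L IH] B k k0k B1.
  rewrite expn1 ltnNge; case/negP; apply: leq_trans (max_card _) _.
  by rewrite card_Fp.
move=> pB covB; have kgt0 := leq_trans (approx_group_gt0 apV) k0k.
have covDB a b : a \in B -> b \in B -> covers V (a - b) (k ^ 3).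
  move=> Ba Bb; apply: coversW (coversD apV (covB a Ba) (coversN apV (covB b Bb))).
  by rewrite !expnS expn0; nia.
(* If all elements are quotients, one division finishes at cost k^8. Otherwise the collision-free
   map replaces [B] by a set of size |B|^2 and uses up one of the [L] squarings. *)
have [allq|[a [b [c [d [/and4P[Ba Bb Bc Bd] cd inj]]]]]] := quotients_or_growth B1.
  move=> x; have [a [b [c [d [/and4P[Ba Bb Bc Bd] cd ->]]]]] := allq x.
  apply: coversW (coversM (covDB a b Ba Bb) (coversV apV _ (covDB c d Bc Bd))); last by rewrite subr_eq0.
  apply: (@leq_trans (k ^ 13)%N); last first.
    by rewrite leq_pexp2l // (leq_pexp2l _ (_ : 1 <= L.+1)%N).
  apply: (@leq_trans (k ^ 3 * (k * k ^ 3 * k))%N).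
    by rewrite leq_mul2l !leq_mul ?orbT.
  by rewrite (_ : k ^ 3 * _ = k ^ 8)%N ?leq_pexp2l //; ring.
pose f (u : 'F_p * 'F_p) := (c - d) * u.1 + (a - b + (c - d)) * u.2.
have cB' : #|[set f u | u in setX B B]| = (#|B| ^ 2)%N.
  by rewrite card_in_imset // cardsX mulnn.
rewrite expnS expnM; apply: (IH [set f u | u in setX B B]).
- by apply: leq_trans k0k _; rewrite -[leqLHS]expn1 leq_pexp2l.
- by rewrite cB' -mulnn; apply: leq_trans B1 (leq_pmulr _ (ltnW B1)).
- by rewrite cB' -expnM -expnS.
move=> _ /imsetP[[u v] /setXP[/= Bu Bv] ->]; rewrite /f /=.
have := coversM (coversD apV (covDB a b Ba Bb) (covDB c d Bc Bd)) (covB v Bv).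
move=> /(coversD apV (coversM (covDB c d Bc Bd) (covB u Bu))); apply: coversW.
apply: (@leq_trans (k ^ 3 * k * (k ^ 3 * k ^ 3 * k * k) * k)%N).
  by rewrite leq_mul // leq_mul2l !leq_mul ?orbT.
by apply/eq_leq; ring.
Qed.
End PrimeField.

(** * Approximate groups from small difference sets, and dilates with large intersection *)

Section SmallDifference.
Variable F : finFieldType.
Implicit Types (A L H B : {set F}).

(** With [S] the popular differences of [A], take V = S + S. Sums of boundedly many copies of [S]
    have size comparable to |A|, so Ruzsa covering by S - S = V applies. If [W], the intersection of
    g A and [A], is dense, then g V + W lies in g (V + A), so g V is covered by translates of W - W,
    hence of A - A, hence of [V]. *)
Lemma approx_group_of_small_difference A K :
  (0 < #|A|)%N -> (1 < K)%N -> (#|sumset A (oppset A)| <= K * #|A|)%N ->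
  exists V : {set F}, [/\ approx_group V (K ^ 17), (#|A| <= 2 * #|V|)%N,
    (#|V| <= K ^ 7 * #|A|)%N &
    forall g b, g != 0 -> (#|A| <= b * #|[set (g * a)%R | a in A] :&: A|)%N ->
      covers V g (K ^ 12 * b)].
Proof.
move=> A0 K1 doubling; have K0 := ltnW K1.
have Kp a b : (2 ^ a * K ^ b <= K ^ (a + b))%N.
  rewrite expnD leq_mul2r; apply/orP; right.
  by case: a => // a; rewrite leq_exp2r.
have grow n := card_iter_sumset n A0 doubling.
have cS := card_popular_diffs K0 doubling.
have Sopp x : x \in popular_diffs A (2 * K) -> - x \in popular_diffs A (2 * K).
  by rewrite popular_diffs_opp.
move: (popular_diffs A (2 * K)) grow cS Sopp => S grow cS Sopp.
have S0 : (0 < #|S|)%N by have := leq_trans A0 cS; rewrite muln_gt0.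
have [a0 Aa0] := card_gt0P A0; have [s0 Ss0] := card_gt0P S0.
have Na0 : - a0 \in oppset A by rewrite mem_oppset opprK.
set V := sumset S S.
have cV : (#|S| <= #|V|)%N.
  rewrite -(card_imset _ (addrI s0)); apply/subset_leq_card/subsetP => _ /imsetP[s Ss ->].
  exact: mem_sumset.
have AV : (#|sumset V A| <= 4 * K ^ 5 * #|A|)%N.
  apply: leq_trans (_ : #|sumset A (iter_sumset S (oppset A) 2)| <= _)%N; last first.
    by apply: leq_trans (grow 2) _; rewrite leq_mul2r; apply/orP; right; apply/eq_leq; ring.
  rewrite -(card_imset (mem (sumset A _)) (addIr a0)).
  apply/subset_leq_card/subsetP => _ /sumsetP[_ [a [/sumsetP[s [s' [Ss Ss' ->]]] Aa ->]]].
  apply/imsetP; exists (a + (s + (s' + (- a0)))); last by ring.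
  by rewrite /= !mem_sumset.
have VA : (#|V| <= #|sumset V A|)%N.
  by rewrite -(card_imset _ (addIr a0)); apply/subset_leq_card/subsetP => _ /imsetP[s Ss ->]; apply: mem_sumset.
exists V; split.
- split; first exact: leq_trans cV.
    move=> _ /sumsetP[s [s' [Ss Ss' ->]]].
    by rewrite opprD mem_sumset ?Sopp.
  (* Four copies of [S] come from V + V and one from the covering set; inserting [a0] and its
     opposite places the sum in A + 5S - A. *)
  have [|T cT covT] := @ruzsa_covering _ (sumset V V) S (64 * K ^ 11) S0.
    apply: leq_trans (_ : #|sumset A (iter_sumset S (oppset A) 5)| <= _)%N.
      apply/subset_leq_card/subsetP => _ /sumsetP[_ [s5 [/sumsetP[_ [_ [/sumsetP[s1 [s2 [S1 S2 ->]]]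
         /sumsetP[s3 [s4 [S3 S4 ->]]] ->]]] S5 ->]]].
      rewrite (_ : _ + _ = a0 + (s1 + (s2 + (s3 + (s4 + (s5 + (- a0))))))); last by ring.
      by rewrite /= !mem_sumset.
    apply: leq_trans (grow 5) _; apply: leq_trans (leq_mul (leqnn _) cS) _.
    by apply/eq_leq; ring.
  exists T; first by apply: leq_trans cT _; exact: (Kp 6 11).
  move=> u v Vu Vv; have [t [w [w' [Tt Sw Sw' ->]]]] := covT _ (mem_sumset Vu Vv).
  exists t => //; rewrite (_ : _ - _ = w + - w'); last by ring.
  by rewrite mem_sumset ?Sopp.
- by apply: leq_trans cS _; rewrite leq_mul2l.
- apply: leq_trans VA (leq_trans AV _); rewrite leq_mul2r; apply/orP; right.
  exact: leq_trans (Kp 2 5).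
move=> g b g0 cW; set W := _ :&: _ in cW.
have W0 : (0 < #|W|)%N by case: #|W| cW => //; rewrite muln0 leqNgt A0.
have [|T cT covT] := @ruzsa_covering _ [set g * v | v in V] W (4 * K ^ 5 * b) W0.
  rewrite -mulnA; apply: leq_trans (leq_mul (leqnn _) cW); apply: leq_trans AV.
  rewrite -(card_imset (mem (sumset V A)) (mulfI g0)).
  apply/subset_leq_card/subsetP => _ /sumsetP[_ [_ [/imsetP[v Vv ->] /setIP[/imsetP[a Aa ->] _] ->]]].
  by rewrite -mulrDr imset_f ?mem_sumset.
have [|T' cT' covT'] := @ruzsa_covering _ (sumset A (oppset A)) S (4 * K ^ 3) S0.
  apply: leq_trans (_ : #|sumset A (iter_sumset S (oppset A) 1)| <= _)%N.
    apply/subset_leq_card/subsetP => _ /sumsetP[_ [s [/sumsetP[a [a' [Aa Aa' ->]]] Ss ->]]].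
    by rewrite (_ : _ + _ = a + (s + a')) /= ?mem_sumset //; ring.
  apply: leq_trans (grow 1) _; apply: leq_trans (leq_mul (leqnn _) cS) _.
  by apply/eq_leq; ring.
exists (sumset T T').
  apply: leq_trans (card_sumset_le _ _) (leq_trans (leq_mul cT cT') _).
  rewrite (_ : _ * _ = b * (16 * K ^ 8))%N; last by ring.
  by rewrite [leqRHS]mulnC leq_mul2l; apply/orP; right; apply: (Kp 4 8).
move=> v Vv; have [t [w [w' [Tt]]]] := covT _ (imset_f _ Vv).
move=> /setIP[_ Aw] /setIP[_ Aw'] ->.
have [|t' [s [s' [Tt' Ss Ss' e]]]] := covT' (w - w').
  by rewrite mem_sumset ?mem_oppset ?opprK.
exists (t + t'); first exact: mem_sumset.
rewrite -(addrA t) e (_ : _ - _ = s + - s'); last by ring.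
by rewrite mem_sumset ?Sopp.
Qed.

(** The dilates h A all lie in [L], so by Cauchy-Schwarz they intersect on average in a share 1/c of
    |A|. Fix an [h'] that is at least average: many h A meet h' A in at least |A|/(2c) points, and
    the h / h' are the required elements. *)
Lemma dense_dilates A L H c :
  (0 < #|A|)%N -> (#|L| <= c * #|A|)%N -> (0 < #|H|)%N ->
  (forall h a, h \in H -> a \in A -> h != 0 /\ h * a \in L) ->
  exists B, (#|H| <= 2 * c * #|B|)%N /\ forall g, g \in B ->
    g != 0 /\ (#|A| <= 2 * c * #|[set (g * a)%R | a in A] :&: A|)%N.
Proof.
move=> A0 cL H0 HA; have [a0 Aa0] := card_gt0P A0.
(* [r x] is the number of dilates h A containing [x]; [I h h'] is the intersection of h A and h'
   A. *)
pose r x := #|[set h in H | x / h \in A]|.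
pose I h h' := [set x in L | (x / h \in A) && (x / h' \in A)].
have sum_r : (\sum_(x in L) r x = #|H| * #|A|)%N.
  rewrite /r (sum_card_swap L H (fun x h => x / h \in A)) -sum_nat_const.
  apply: eq_bigr => h Hh; have [h0 _] := HA h a0 Hh Aa0.
  rewrite -(card_imset (mem A) (mulfI h0)); apply: eq_card => x; rewrite inE.
  apply/andP/imsetP => [[_ xh]|[a Aa ->]]; first by exists (x / h); rewrite // mulrC divfK.
  by have [_ ->] := HA h a Hh Aa; rewrite mulrAC divff ?mul1r.
have sum_r2 : (\sum_(x in L) r x ^ 2 = \sum_(h' in H) \sum_(h in H) #|I h h'|)%N.
  transitivity (\sum_(x in L) #|[set u in setX H H | (x / u.1 \in A) && (x / u.2 \in A)]|)%N.
    apply: eq_bigr => x _; rewrite -mulnn -cardsX; apply: eq_card => -[h h']; rewrite !inE /=.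
    by case: (h \in H); case: (h' \in H); rewrite ?andbF.
  rewrite (sum_card_swap L (setX H H) (fun x u => (x / u.1 \in A) && (x / u.2 \in A))).
  rewrite exchange_big pair_big /=; apply: eq_big => [[h h']|[h h'] _]; first by rewrite !inE.
  by apply: eq_card => x; rewrite !inE.
have [h' Hh' big] : exists2 h', h' \in H & (#|H| * #|A| <= c * \sum_(h in H) #|I h h'|)%N.
  apply/exists_inP; apply: contraT; rewrite negb_exists_in => /forall_inP none; exfalso.
  have := sqr_sumn_le L r; rewrite sum_r sum_r2.
  have : (c * \sum_(h' in H) \sum_(h in H) #|I h h'| + #|H| <= #|H| * (#|H| * #|A|))%N.
    rewrite big_distrr /= -{1}sum1_card -big_split -sum_nat_const /=.
    by apply: leq_sum => h /none; rewrite -ltnNge addn1.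
  move: (\sum_(h' in H) _)%N cL A0 H0; rewrite -mulnn; move: #|A| #|L| #|H| => a l h s la a0' h0 h1 h2.
  have : (h * a * (h * a) <= c * a * s)%N by apply: leq_trans h2 _; rewrite leq_mul2r la orbT.
  rewrite (_ : _ * (h * a) = a * (h * (h * a)))%N; last by ring.
  rewrite (_ : c * a * s = a * (c * s))%N; last by ring.
  by rewrite leq_pmul2l //; lia.
have [h'0 _] := HA h' a0 Hh' Aa0.
pose Hg := [set h in H | #|A| <= 2 * c * #|I h h'|]%N.
have IA h : h \in H -> (#|I h h'| <= #|A|)%N.
  move=> Hh; have [h0 _] := HA h a0 Hh Aa0; rewrite -(card_imset _ (mulIf (invr_neq0 h0))).
  by apply/subset_leq_card/subsetP => _ /imsetP[x + ->]; rewrite inE => /and3P[].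
exists [set h / h' | h in Hg]; split.
  rewrite card_imset; last by apply: mulIf; apply: invr_neq0.
  have : (2 * c * \sum_(h in H) #|I h h'| <= 2 * c * (#|Hg| * #|A|) + #|H| * #|A|)%N.
    rewrite (bigID (mem Hg)) /= mulnDr; apply: leq_add.
      rewrite leq_mul2l; apply/orP; right.
      apply: leq_trans (_ : \sum_(i in H | i \in Hg) #|A| <= _)%N.
        by apply: leq_sum => h /andP[/IA].
      rewrite sum_nat_const leq_mul2r; apply/orP; right.
      by apply/subset_leq_card/subsetP => x /andP[].
    rewrite big_distrr /=.
    apply: leq_trans (_ : \sum_(i in H | i \notin Hg) #|A| <= _)%N.
      by apply: leq_sum => h /andP[Hh]; rewrite inE Hh -ltnNge => /ltnW.
    rewrite sum_nat_const leq_mul2r; apply/orP; right.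
    by apply/subset_leq_card/subsetP => x /andP[].
  move: (\sum_(h in H) _)%N big A0 => s big A0 le.
  rewrite -(leq_pmul2r A0); move: big le; move: #|A| #|H| #|Hg| => a h hg; nia.
move=> _ /imsetP[h + ->]; rewrite inE => /andP[Hh big1].
have [h0 _] := HA h a0 Hh Aa0; split; first by rewrite mulf_neq0 ?invr_neq0.
apply: leq_trans big1 _; rewrite leq_mul2l; apply/orP; right.
rewrite -(card_imset _ (mulIf (invr_neq0 h'0))).
apply/subset_leq_card/subsetP => _ /imsetP[x + ->]; rewrite !inE => /and3P[_ xh xh'].
rewrite xh' andbT; apply/imsetP; exists (x / h) => //.
by field; apply/andP.
Qed.
End SmallDifference.

(** To be applied with [L] and [L'] consecutive large spectra and [H] the group of m-th powers. The
    approximate group obtained from [L] is covered under all dilations by few translates of itself,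
    so [card_le_of_covers] makes it nearly everything or tiny. *)
Lemma invariant_set_dichotomy (n : nat) : exists C : nat,
  forall (p K h : nat) (L L' H : {set 'F_p}), prime p -> (1 < K)%N ->
    (0 < #|L|)%N -> (#|L'| <= K * #|L|)%N ->
    (#|L| ^ 2 <= K * \sum_(v in L) #|diff_nbhd L L' v|)%N ->
    (forall g x, g \in H -> x \in L -> g != 0 /\ g * x \in L) ->
    (K ^ 4 * h <= #|H|)%N -> (1 < h)%N -> (p < h ^ (2 ^ n))%N ->
  (p <= K ^ C * #|L|)%N \/ (#|L| <= K ^ C)%N.
Proof.
(* The dilations start with covering number K^(23*17), raised to the power 13 in each of [n] growth
   steps; 1000 leaves room for the remaining fixed powers of [K]. *)
exists (1000 + (23 * 17) * 13 ^ n)%N => p K h L L' H p_pr K1 L0 leL' dense HL hH h1 ph.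
have K0 := ltnW K1.
have [A [AL LA AA]] := balog_szemeredi_gowers L0 leL' dense.
have A0 : (0 < #|A|)%N.
  by case: #|A| LA => //; rewrite exp0n // muln0 leqNgt expn_gt0 L0.
(* Since K >= 2, numerical constants are absorbed into powers of [K]. *)
have KA a b : (2 ^ a * K ^ b <= K ^ (a + b))%N.
  rewrite expnD leq_mul2r; apply/orP; right.
  by case: a => // a; rewrite leq_exp2r.
have cL : (#|L| <= K ^ 3 * #|A|)%N.
  rewrite -leq_sqr; apply: leq_trans LA _; rewrite expnMn leq_mul2r; apply/orP; right.
  apply: leq_trans (KA 3 2)%N _; rewrite -expnM; exact: leq_pexp2l.
have {}AA : (#|sumset A (oppset A)| <= K ^ 23 * #|A|)%N.
  apply: leq_trans AA _; rewrite leq_mul2r; apply/orP; right; exact: (KA 13 10)%N.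
have K23 : (1 < K ^ 23)%N by rewrite -{1}(exp1n 23) ltn_exp2r.
have [V [apV AV VA covV]] := approx_group_of_small_difference A0 K23 AA.
have H0 : (0 < #|H|)%N by apply: leq_trans hH; rewrite muln_gt0 expn_gt0 K0 ltnW.
have [|B [cB covB]] := dense_dilates A0 cL H0.
  by move=> g a Hg Aa; apply: HL => //; apply: (subsetP AL).
have hB : (h <= #|B|)%N.
  rewrite -(leq_pmul2l (_ : 0 < K ^ 4)%N) ?expn_gt0 ?K0 // (leq_trans hH) //.
  apply: leq_trans cB _; rewrite leq_mul2r; apply/orP; right; exact: (KA 1 3)%N.
have covB' x : x \in B -> covers V x (K ^ (23 * 17)).
  move=> /covB[x0 cx]; apply: coversW (covV _ _ x0 cx).
  rewrite -expnM; apply: leq_trans (leq_mul (leqnn _) (KA 1 3)%N) _.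
  by rewrite -expnD leq_pexp2l.
have h0 : ((K ^ 23) ^ 17 <= K ^ (23 * 17))%N by rewrite expnM.
have pB : (p < #|B| ^ (2 ^ n))%N by apply: leq_trans ph _; rewrite leq_exp2r ?expn_gt0.
have cov := covers_all p_pr apV h0 (leq_trans h1 hB) pB covB'.
have {}cov x : covers V x (K ^ (23 * 17 * 13 ^ n)) by rewrite expnM.
set e := (23 * 17 * 13 ^ n)%N in cov *.
have [big|small] := card_le_of_covers apV cov; [left|right].
  rewrite card_Fp // in big; apply: (leq_trans big); rewrite -!expnM.
  have cVL : (#|V| <= K ^ (23 * 7) * #|L|)%N.
    apply: leq_trans VA _; rewrite expnM leq_mul2l; apply/orP; right.
    exact: subset_leq_card.
  apply: leq_trans (leq_mul (leqnn _) cVL) _; rewrite mulnA leq_mul2r; apply/orP; right.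
  apply: (@leq_trans (2 ^ 2 * K ^ (e + 23 * (17 * 2)) * K ^ (23 * 7))%N).
    rewrite leq_mul2r; apply/orP; right; rewrite expnD.
    have : (0 < K ^ e * K ^ (23 * (17 * 2)))%N by rewrite muln_gt0 !expn_gt0 K0.
    move: (K ^ e)%N (K ^ (23 * (17 * 2)))%N => u v uv.
    by rewrite -mulnA ltn_pmul2r.
  apply: leq_trans (leq_mul (KA _ _) (leqnn _)) _.
  rewrite -expnD leq_exp2l // addnA [(2 + e + _)%N]addnAC addnAC leq_add2r.
  by [].
apply: leq_trans cL _.
apply: leq_trans (leq_mul (leqnn _) (leq_trans AV (_ : _ <= 2 ^ 2 * K ^ e)%N)) _.
  by rewrite (_ : 2 ^ 2 = 2 * 2)%N // -mulnA leq_mul2l /= ltnW.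
apply: leq_trans (leq_mul (leqnn _) (KA _ _)) _.
by rewrite -expnD leq_exp2l // addnA leq_add2r.
Qed.

(** * Gauss sums *)

Section GaussSums.
Variables (C : numClosedFieldType) (p : nat) (w : C) (m : nat).
Hypotheses (p_pr : prime p) (w_prim : p.-primitive_root w) (m_gt0 : (0 < m)%N).
Implicit Types (x y a b : 'F_p).

(** The exponent is the representative of [x] below [p]; as [w] has order [p], this is a nontrivial
    additive character. *)
Definition addchar x : C := w ^+ x.
Definition gauss_sum a : C := \sum_(x in [set~ 0]) addchar (a * x ^+ m).

Local Notation e := addchar.
Local Notation phi := gauss_sum.

Lemma card_nonzero : #|[set~ (0 : 'F_p)]| = p.-1.
Proof. by rewrite cardsC1 card_Fp. Qed.

Lemma addcharD x y : e (x + y) = e x * e y.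
Proof.
rewrite /e -exprD; apply/eqP; rewrite (eq_prim_root_expr w_prim) /=.
by rewrite [X in _ == _ %[mod X]](_ : p = (Zp_trunc (pdiv p)).+2) ?modn_mod // Fp_cast.
Qed.

Lemma addchar0 : e 0 = 1.
Proof. by []. Qed.

Lemma addchar_norm x : `|e x| = 1.
Proof.
rewrite /e normrX; have := prim_expr_order w_prim.
move/(congr1 Num.norm); rewrite normrX normr1 => /eqP.
by rewrite pexpr_eq1 ?normr_ge0 ?prime_gt0 // => /eqP ->; rewrite expr1n.
Qed.

Lemma addchar_neq0 x : e x != 0.
Proof. by rewrite -normr_eq0 addchar_norm oner_eq0. Qed.

Lemma addcharN x : e (- x) = (e x)^*.
Proof.
apply: (mulIf (addchar_neq0 x)); rewrite -addcharD addNr addchar0.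
by rewrite mulrC -normCK addchar_norm expr1n.
Qed.

Lemma addchar_sum (I : finType) (P : pred I) (f : I -> 'F_p) :
  e (\sum_(i | P i) f i) = \prod_(i | P i) e (f i).
Proof. by apply: (big_morph e addcharD addchar0). Qed.

Lemma addchar_exp x k : e x ^+ k = e (k%:R * x).
Proof.
elim: k => [|k IH]; first by rewrite mul0r addchar0.
by rewrite exprS IH -addcharD -natr1 mulrDl mul1r addrC.
Qed.

Lemma addchar1_neq1 : e 1 != 1.
Proof.
rewrite /e -(prim_order_dvd w_prim) /= Fp_cast //.
rewrite modn_small ?prime_gt1 // gtnNdvd ?prime_gt1 //.
Qed.

Lemma sum_addchar a : \sum_x e (x * a) = if a == 0 then p%:R else 0.
Proof.
have [->|a0] := eqVneq a 0.
  under eq_bigr do rewrite mulr0 addchar0.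
  by rewrite sumr_const card_Fp.
rewrite (reindex_onto (fun x => x / a) (fun x => x * a)) /=; last by move=> x _; rewrite mulfK.
rewrite (eq_bigl predT) => [|x]; last by rewrite divfK // eqxx.
under eq_bigr do rewrite divfK //.
set s := \sum_(_ | _) _.
have : s = e 1 * s.
  rewrite {1}/s (reindex_inj (addrI 1)) /= mulr_sumr.
  by apply: eq_bigr => x _; rewrite addcharD.
move/eqP; rewrite -subr_eq0 -{1}(mul1r s) -mulrBl mulf_eq0 subr_eq0 eq_sym.
by rewrite (negbTE addchar1_neq1) => /eqP.
Qed.

Lemma gauss_sum_le a : `|phi a| <= p.-1%:R.
Proof.
apply: le_trans (ler_norm_sum _ _ _) _.
under eq_bigr do rewrite addchar_norm.
by rewrite sumr_const card_nonzero.
Qed.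

Lemma gauss_sum_dilate a y : y != 0 -> phi (a * y ^+ m) = phi a.
Proof.
move=> y0; rewrite /phi [RHS](reindex_inj (mulfI y0)) /=.
apply: eq_big => [x|x _]; first by rewrite !inE mulf_eq0 (negbTE y0).
by rewrite exprMn mulrA.
Qed.

Lemma card_expr_fiber (c : 'F_p) : (#|[set y | (y ^+ m == c)%R]| <= m)%N.
Proof.
pose q : {poly 'F_p} := 'X^m - c%:P.
have sq : size q = m.+1 by rewrite size_XnsubC.
have q0 : q != 0 by rewrite -size_poly_eq0 sq.
rewrite cardE; have := max_poly_roots q0 _ (enum_uniq _); rewrite sq; apply.
apply/allP => y; rewrite mem_enum inE => /eqP yc.
by rewrite rootE !hornerE yc subrr.
Qed.

(** Orthogonality leaves [p] times the number of pairs of nonzero x, y with equal m-th powers, and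
    each x has at most [m] partners. *)
Lemma gauss_sum_parseval : \sum_a `|phi a| ^+ 2 <= (p * (p.-1 * m))%:R.
Proof.
have -> : \sum_a `|phi a| ^+ 2
   = \sum_(x in [set~ 0]) \sum_(y in [set~ 0]) \sum_a e (a * (x ^+ m - y ^+ m)).
  transitivity (\sum_a \sum_(x in [set~ 0]) \sum_(y in [set~ 0]) e (a * (x ^+ m - y ^+ m))).
    apply: eq_bigr => a _; rewrite normCK rmorph_sum mulr_suml; apply: eq_bigr => x _.
    rewrite mulr_sumr; apply: eq_bigr => y _.
    by rewrite /= -addcharN -addcharD mulrBr.
  by rewrite exchange_big; apply: eq_bigr => x _; rewrite exchange_big.
rewrite mulnCA natrM -card_nonzero mulr_natl -sumr_const; apply: ler_sum => x _.
under eq_bigr do rewrite sum_addchar.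
rewrite -big_mkcondr sumr_const /= -mulrnA ler_nat leq_mul2l; apply/orP; right.
apply: leq_trans (card_expr_fiber (x ^+ m)).
apply/subset_leq_card/subsetP => y /andP[_].
by rewrite inE subr_eq0 eq_sym.
Qed.

(* Positive definiteness of [phi], tested against the unimodular
   coefficients [c a] that turn [phi a] into its absolute value. *)
Lemma gauss_sum_positivity (A : {set 'F_p}) :
  (\sum_(a in A) `|phi a|) ^+ 2 <= p.-1%:R * \sum_(a in A) \sum_(b in A) `|phi (a - b)|.
Proof.
pose c a : C := if phi a == 0 then 1 else `|phi a| / phi a.
have cphi a : c a * phi a = `|phi a|.
  by rewrite /c; case: eqVneq => [->|h]; rewrite ?normr0 ?mulr0 // divfK.
have cnorm a : `|c a| = 1.
  rewrite /c; case: eqVneq => [_|h]; rewrite ?normr1 //.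
  by rewrite normrM normfV normr_id divff // normr_eq0.
pose z x := \sum_(a in A) c a * e (a * x ^+ m).
have -> : \sum_(a in A) `|phi a| = \sum_(x in [set~ 0]) z x.
  rewrite exchange_big; apply: eq_bigr => a _.
  by rewrite -cphi mulr_sumr.
have -> : (\sum_(x in [set~ 0]) z x) ^+ 2 = `|\sum_(x in [set~ 0]) z x| ^+ 2.
  rewrite ger0_norm // exchange_big; apply: sumr_ge0 => a _.
  by rewrite -mulr_sumr -/(phi a) cphi.
apply: (@le_trans _ _ ((\sum_(x in [set~ 0]) `|z x|) ^+ 2)).
  by rewrite lerXn2r ?nnegrE ?sumr_ge0 // ler_norm_sum.
apply: le_trans (sqr_sumr_le _ (fun x => normr_real (z x))) _.
rewrite card_nonzero ler_wpM2l ?ler0n //.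
have e1 : \sum_(x in [set~ 0]) `|z x| ^+ 2
    = \sum_(a in A) \sum_(b in A) c a * (c b)^* * phi (a - b).
  transitivity (\sum_(x in [set~ 0]) \sum_(a in A) \sum_(b in A)
      c a * (c b)^* * e ((a - b) * x ^+ m)).
    apply: eq_bigr => x _; rewrite normCK rmorph_sum mulr_suml; apply: eq_bigr => a _.
    rewrite mulr_sumr; apply: eq_bigr => b _.
    by rewrite rmorphM /= -addcharN mulrACA -addcharD mulrBl.
  rewrite exchange_big; apply: eq_bigr => a _; rewrite exchange_big; apply: eq_bigr => b _.
  by rewrite mulr_sumr.
have s0 : 0 <= \sum_(x in [set~ 0]) `|z x| ^+ 2 by apply: sumr_ge0 => x _; rewrite exprn_ge0.

rewrite -(ger0_norm s0) e1; apply: le_trans (ler_norm_sum _ _ _) _.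
apply: ler_sum => a _; apply: le_trans (ler_norm_sum _ _ _) _.
by apply: ler_sum => b _; rewrite !normrM norm_conjC !cnorm !mul1r.
Qed.
End GaussSums.

(** * The large spectrum of Gauss sums *)

Section LargeSpectrum.
Variables (C : numClosedFieldType) (p : nat) (w : C) (m : nat).
Hypotheses (p_pr : prime p) (w_prim : p.-primitive_root w) (m_gt0 : (0 < m)%N).
Implicit Types (x y a b : 'F_p).
Local Notation phi := (gauss_sum (p := p) w m).

Definition large_spectrum (M : nat) : {set 'F_p} := [set a | p.-1%:R <= `|phi a| * M%:R].

Let P0 : 0 < p.-1%:R :> C.
Proof. by rewrite ltr0n -ltnS prednK ?prime_gt0 ?prime_gt1. Qed.

Lemma large_spectrum_dilate M y a : y != 0 ->
  (a * y ^+ m \in large_spectrum M) = (a \in large_spectrum M).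
Proof. by move=> y0; rewrite !inE gauss_sum_dilate. Qed.

Lemma large_spectrumS M N : (M <= N)%N -> large_spectrum M \subset large_spectrum N.
Proof.
move=> MN; apply/subsetP => a; rewrite !inE => /le_trans; apply.
by rewrite ler_wpM2l ?ler_nat.
Qed.

Lemma card_large_spectrum M : (#|large_spectrum M| * p.-1 <= M ^ 2 * (p * m))%N.
Proof.
rewrite -(ler_nat C) natrM [leRHS]natrM natrX -(ler_pM2l P0).
apply: (@le_trans _ _ (\sum_(a in large_spectrum M) (`|phi a| * M%:R) ^+ 2)).
  rewrite mulrCA -expr2 mulr_natl -sumr_const; apply: ler_sum => a; rewrite inE => h.
  by rewrite lerXn2r // nnegrE ?ler0n // mulr_ge0 ?ler0n.
apply: (@le_trans _ _ (M%:R ^+ 2 * \sum_a `|phi a| ^+ 2)).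
  rewrite mulr_sumr [leRHS](bigID (mem (large_spectrum M))) /=.
  apply: ler_wpDr; first by apply: sumr_ge0 => a _; rewrite mulr_ge0 ?exprn_ge0 ?ler0n.
  by apply: ler_sum => a _; rewrite exprMn mulrC.
rewrite mulrCA ler_wpM2l ?exprn_ge0 ?ler0n //.
apply: le_trans (gauss_sum_parseval p_pr w_prim m_gt0) _.
by rewrite -natrM ler_nat; apply/eq_leq; ring.
Qed.

Definition powers : {set 'F_p} := [set x ^+ m | x in [set~ 0]].

Lemma card_powers : (p.-1 <= #|powers| * m)%N.
Proof.
set H := powers.
rewrite -(card_nonzero p_pr) -sum1_card -sum_nat_const.
have -> : (\sum_(x in [set~ (0%R : 'F_p)]) 1 = \sum_(x in [set~ (0%R : 'F_p)]) #|[set y in H | (x ^+ m == y)%R]|)%N.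
  apply: eq_bigr => x x0; rewrite -(cards1 (x ^+ m)); apply: eq_card => y.
  rewrite !inE eq_sym; case: eqVneq => [<-|]; last by rewrite andbF.
  by rewrite andbT; apply/esym/imset_f.
rewrite (sum_card_swap [set~ 0%R] H (fun x y => x ^+ m == y)); apply: leq_sum => y _.
apply: leq_trans (card_expr_fiber m_gt0 y); apply/subset_leq_card/subsetP => x.
by rewrite !inE => /andP[].
Qed.

(** By positivity the |phi (a - b)| over pairs of the spectrum sum to at least (p-1) |L|^2 / M^2.
    Differences outside the level 2 M^2 contribute at most half of this, and each other one at most
    p - 1. *)
Lemma large_spectrum_differences M :
  (#|large_spectrum M| ^ 2 <= 2 * M ^ 2 * \sum_(v in large_spectrum M)
     #|diff_nbhd (large_spectrum M) (large_spectrum (2 * M ^ 2)) v|)%N.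
Proof.
set L := large_spectrum M; set M' := (2 * M ^ 2)%N; set L' := large_spectrum M'; set E := (\sum_(v in L) _)%N.
pose S := \sum_(a in L) \sum_(b in L) `|phi (a - b)|.
have S_ge : (#|L|%:R * p.-1%:R) ^+ 2 <= M%:R ^+ 2 * (p.-1%:R * S).
  apply: le_trans (_ : M%:R ^+ 2 * (\sum_(a in L) `|phi a|) ^+ 2 <= _); last first.
    by rewrite ler_wpM2l ?exprn_ge0 ?ler0n //; apply: gauss_sum_positivity.
  rewrite -exprMn lerXn2r // ?nnegrE ?mulr_ge0 ?ler0n ?sumr_ge0 //.
  rewrite mulr_natl -sumr_const mulr_sumr; apply: ler_sum => a.
  by rewrite inE mulrC.
have S_le : M'%:R * S <= p.-1%:R * (M'%:R * E%:R + #|L|%:R ^+ 2).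
  have -> : p.-1%:R * (M'%:R * E%:R + #|L|%:R ^+ 2)
     = \sum_(b in L) \sum_(a in L) p.-1%:R * (M'%:R * (a - b \in L')%:R + 1) :> C.
    under eq_bigr do rewrite -mulr_sumr big_split /= -mulr_sumr sumr_const.
    rewrite -mulr_sumr big_split /= sumr_const -mulr_sumr [in LHS]expr2 (mulr_natr #|L|%:R).
    rewrite /E natr_sum; congr (_ * (_ * _ + _)); apply: eq_bigr => v _.
    rewrite -sum1_card natr_sum big_mkcond [RHS]big_mkcond /=; apply: eq_bigr => a _.
    by rewrite /diff_nbhd in_set; case: (_ \in L); case: (_ \in L').
  rewrite /S exchange_big mulr_sumr; apply: ler_sum => b _.
  rewrite mulr_sumr; apply: ler_sum => a _.
  have [_|] := boolP (a - b \in L').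
    rewrite mulr1 mulrDr mulr1 mulrC; apply: ler_wpDr; first exact: ltW.
    by rewrite ler_wpM2r ?ler0n // gauss_sum_le.
  rewrite inE mulr0 add0r mulr1 mulrC.
  by rewrite -real_ltNge ?realM ?realn // => /ltW.
rewrite -(ler_nat C) natrX natrM.
have h : 2 * (#|L|%:R * p.-1%:R) ^+ 2 <= p.-1%:R ^+ 2 * (M'%:R * E%:R + #|L|%:R ^+ 2) :> C.
  apply: (@le_trans _ _ (p.-1%:R * (M'%:R * S))).
    apply: le_trans (ler_wpM2l _ S_ge) _; rewrite ?ler0n //.
    by rewrite /M' natrM natrX le_eqVlt; apply/orP; left; apply/eqP; ring.
  by rewrite expr2 -mulrA ler_wpM2l // ltW.
have P2 : 0 < p.-1%:R ^+ 2 :> C by rewrite exprn_gt0.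
rewrite -(ler_pM2l P2) -(lerD2r (p.-1%:R ^+ 2 * #|L|%:R ^+ 2)) -[leRHS]mulrDr.
by apply: le_trans h; rewrite le_eqVlt; apply/orP; left; apply/eqP; ring.
Qed.
End LargeSpectrum.

(** If every step grew by more than the factor [K], then [f J] would reach K^J. *)
Lemma slow_growth_step (f : nat -> nat) (K N J : nat) :
  (0 < f 0)%N -> (f J <= N)%N -> (N < K ^ J)%N -> exists2 j, (j < J)%N & (f j.+1 <= K * f j)%N.
Proof.
move=> f0 fJ NK; case: (pickP (fun j : 'I_J => f j.+1 <= K * f j)%N) => [j|none].
  by exists j.
have: forall j, (j <= J)%N -> (K ^ j <= f j)%N.
  elim=> [|j IH] jJ; first by rewrite expn0.
  have := none (Ordinal jJ) => /=; move/negbT; rewrite -ltnNge => /ltnW; apply: leq_trans.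
  by rewrite expnS leq_mul2l IH ?orbT // ltnW.
by move=> /(_ J (leqnn J)) KJ; move: (leq_trans NK (leq_trans KJ fJ)); rewrite ltnn.
Qed.

Lemma gauss_sum_bound (D : nat) : (0 < D)%N -> exists R : nat, (0 < R)%N /\
  forall (C : numClosedFieldType) (p : nat) (w : C) (m M : nat) (a : 'F_p),
    prime p -> p.-primitive_root w -> (0 < m)%N -> (m ^ D < p ^ D.-1)%N ->
    (1 < M)%N -> (M ^ R <= p < M ^ (2 * R))%N -> a != 0 ->
  `|gauss_sum w m a| * M%:R < p.-1%:R.
Proof.
move=> D0; have [C0 dichotomy] := invariant_set_dichotomy D.+1.
(* With K = M^(3^J), the hypothesis on [M] reads K^(Q D) <= p < K^J: [K] is a small power of [p],
   yet [J] levels suffice for the pigeonhole. *)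
pose Q := (C0 + 13)%N; pose J := (2 * (Q * D))%N; exists (3 ^ J * (Q * D))%N; split.
  by rewrite muln_gt0 expn_gt0 muln_gt0 D0 addn_gt0 orbT.
move=> C p w m M a p_pr w_prim m0 mp M1 /andP[Mp pM] a0.
set K := (M ^ (3 ^ J))%N.
have KQ : (K ^ (Q * D) <= p)%N by rewrite -expnM.
have KJ : (p < K ^ J)%N by rewrite -expnM mulnCA -/J.
have K1 : (1 < K)%N by rewrite -(exp1n (3 ^ J)) ltn_exp2r // expn_gt0.
have p1 := prime_gt1 p_pr.
rewrite real_ltNge ?realM ?normr_real ?realn //; apply/negP => aM.
(* Successive levels as in [large_spectrum_differences]; since 2 M^2 <= M^3, they stay below
   M^(3^j). *)
pose Ms j := iter j (fun M => 2 * M ^ 2)%N M.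
have Ms_ge j : (M <= Ms j)%N.
  elim: j => //= j IH; apply: leq_trans IH _; rewrite -mulnn -/(Ms j).
  by move: (Ms j) => x; nia.
have Ms_le j : (Ms j <= M ^ (3 ^ j))%N.
  elim: j => [|j IH] //=; apply: leq_trans (_ : M * (M ^ (3 ^ j)) ^ 2 <= _)%N.
    by apply: leq_mul => //; rewrite leq_sqr.
  by rewrite -expnM -expnS leq_exp2l // [X in (_ <= X)%N]expnS; have := expn_gt0 3 j; lia.
pose L j := large_spectrum p w m (Ms j).
have aL j : a \in L j.
  by apply: (subsetP (large_spectrumS p w m (Ms_ge j))); rewrite inE.
have [||j jJ Lj] := @slow_growth_step (fun j => #|L j|) K p J _ _ KJ.
- by apply/card_gt0P; exists a.
- by rewrite -[leqRHS](card_Fp p_pr) max_card.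
have MK : (Ms j.+1 <= K)%N by apply: leq_trans (Ms_le _) _; rewrite leq_exp2l // leq_exp2l.
set H := powers p m.
(* |H| >= (p-1)/m, and m^D < p^(D-1) turns this into a lower bound by a power of [p]. *)
have Hbig : (p < (2 * #|H|) ^ D)%N.
  have pHm : (p <= 2 * #|H| * m)%N.
    by have := card_powers p_pr m0; rewrite -/H; move: #|H| => h; nia.
  have : (0 < 2 * #|H|)%N by move: pHm p1; case: #|H| => //; lia.
  move: (2 * #|H|)%N pHm => h pHm h0.
  have : (p ^ D <= h ^ D * m ^ D)%N by rewrite -expnMn leq_exp2r.
  rewrite -{1}(prednK D0) expnS => le1.
  rewrite -(ltn_pmul2r (_ : 0 < p ^ D.-1)%N) ?expn_gt0 ?(ltnW p1) //.
  by apply: leq_ltn_trans le1 _; rewrite ltn_pmul2l // expn_gt0 h0.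
have KH : (K ^ (C0 + 12) < #|H|)%N.
  rewrite -(ltn_pmul2l (isT : 0 < 2)%N).
  apply: (@leq_ltn_trans (K ^ Q)%N).
    by rewrite (_ : Q = (C0 + 12).+1) ?expnS ?leq_mul2r ?K1 ?orbT // /Q addnS.
  by rewrite -(ltn_exp2r _ _ D0) -expnM; apply: leq_ltn_trans KQ Hbig.
(* The loss K^4 is the one in the hypothesis of the dichotomy; [h] remains a power of [p] because
   K^(12 D) <= p. *)
pose h := (#|H| %/ K ^ 4)%N.
have K0 := ltnW K1.
have Kh : (2 * #|H| <= h * K ^ 6)%N.
  have K4 : (K ^ 4 <= #|H|)%N.
    by apply: leq_trans (ltnW KH); rewrite leq_exp2l // addnC.
  have h0 : (0 < h)%N by rewrite divn_gt0 // expn_gt0 K0.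
  have := ltn_ceil #|H| (_ : 0 < K ^ 4)%N; rewrite expn_gt0 K0 -/h => /(_ isT).
  rewrite (_ : K ^ 6 = K ^ 4 * (K * K))%N; last by ring.
  have : (4 <= K * K)%N by apply: (leq_mul K1 K1).
  move: (K ^ 4)%N (K * K)%N h0 => x y; move: h #|H| => u v; nia.
have ph : (p < h ^ (2 * D))%N.
  have : (p * p < h ^ (2 * D) * p)%N.
    have pD : (p < (h * K ^ 6) ^ D)%N.
      by apply: leq_trans Hbig _; rewrite leq_exp2r.
    apply: leq_trans (ltn_mul pD pD) _.
    have K12 : (K ^ (12 * D) <= p)%N.
      by apply: leq_trans KQ; rewrite leq_exp2l // leq_mul2r /Q; apply/orP; right; lia.
    apply: leq_trans (leq_mul (leqnn _) K12); apply/eq_leq.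
    by rewrite mulnn -expnM expnMn -expnM (mulnC D); congr (_ * _ ^ _)%N; ring.
  by rewrite ltn_pmul2r // ltnW.
have h1 : (1 < h)%N.
  move: ph; case: (h) => [|[|//]]; last by rewrite exp1n ltnNge ltnW.
  by rewrite exp0n // muln_gt0.
have ph' : (p < h ^ (2 ^ D.+1))%N.
  apply: leq_trans ph _; rewrite leq_exp2l // expnS leq_mul2l /=.
  exact/ltnW/ltn_expl.
have L0 : (0 < #|L j|)%N by apply/card_gt0P; exists a.
have [|||pL|LK] := dichotomy p K h (L j) (L j.+1) H p_pr K1 L0 Lj _ _ _ h1 ph'.
- apply: leq_trans (large_spectrum_differences m p_pr w_prim (Ms j)) _.
  by rewrite leq_mul2r -/(Ms j.+1) MK orbT.
- move=> _ x /imsetP[y + ->] Lx; rewrite in_setC1 => y0; split; first by rewrite expf_neq0.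
  by rewrite mulrC; have := large_spectrum_dilate w m (Ms j) x y0; rewrite /L => ->.
- by rewrite mulnC leq_trunc_div.
- 
  (* A nearly full spectrum contradicts Parseval, which bounds it by K m. *)
  have LKm : (#|L j| <= K * m)%N.
    have := card_large_spectrum p_pr w_prim m0 (Ms j); rewrite -/(L j) => le1.
    rewrite -(leq_pmul2r (ltnW p1)).
    apply: (@leq_trans (2 * Ms j ^ 2 * (p * m))%N).
      by move: le1; move: #|L j| (Ms j ^ 2)%N p1 => u v; nia.
    by rewrite -/(Ms j.+1) -[leqRHS]mulnA (mulnC m); apply: leq_mul.
  have {pL} pKm : (p <= K ^ C0.+1 * m)%N.
    by apply: leq_trans pL _; rewrite expnSr -mulnA leq_mul2l LKm orbT.
  have : (p ^ D <= K ^ (C0.+1 * D) * m ^ D)%N by rewrite expnM -expnMn leq_exp2r.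
  rewrite -{1}(prednK D0) expnS => le1.
  have : (p * p ^ D.-1 < K ^ (C0.+1 * D) * p ^ D.-1)%N.
    by apply: leq_ltn_trans le1 _; rewrite ltn_pmul2l // expn_gt0 K0.
  rewrite ltn_pmul2r ?expn_gt0 ?(ltnW p1) // ltnNge => /negP; apply.
  by apply: leq_trans KQ; rewrite leq_exp2l // leq_mul2r /Q; apply/orP; right; lia.
(* A tiny spectrum contradicts invariance: it contains the orbit of [a] under [H]. *)
have HL : (#|H| <= #|L j|)%N.
  rewrite -(card_imset _ (mulfI a0)).
  apply/subset_leq_card/subsetP => _ /imsetP[_ /imsetP[y + ->] ->]; rewrite in_setC1 => y0.
  by have := large_spectrum_dilate w m (Ms j) a y0; rewrite -/(L j) (aL j) => ->.
have := leq_trans KH (leq_trans HL LK); rewrite ltn_exp2l //.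
by rewrite ltnNge leq_addr.
Qed.

(** * Elementary symmetric functions *)

Section ElementarySymmetric.
Variables (C : numFieldType) (T : finType) (y : T -> C).
Implicit Types (A S : {set T}) (x : T).

Definition elsym A k : C :=
  \sum_(S : {set T} | (S \subset A) && (#|S| == k)) \prod_(x in S) y x.
Definition psum A j : C := \sum_(x in A) y x ^+ j.
(** Interpolates between the power sum (k = 0) and (k+1) e_(k+1) (j = 1); [hook_sumS] trades one
    unit of [k] for one of [j]. *)
Definition hook_sum A j k : C := \sum_(x in A) y x ^+ j * elsym (A :\ x) k.

Lemma elsym0 A : elsym A 0 = 1.
Proof.
rewrite /elsym (big_pred1 set0) ?big_set0 // => S.
rewrite cards_eq0 /=; case: eqVneq => [->|]; last by rewrite andbF.
by rewrite sub0set.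
Qed.

Lemma mul_elsymD1 A x k : x \in A -> y x * elsym (A :\ x) k =
  \sum_(S : {set T} | (S \subset A) && (#|S| == k.+1) && (x \in S)) \prod_(z in S) y z.
Proof.
move=> Ax; rewrite mulr_sumr.
rewrite [RHS](reindex_onto (fun S => x |: S) (fun S => S :\ x)) /=; last first.
  by move=> S /andP[_ Sx]; rewrite setD1K.
apply: eq_big => [S|S /andP[+ _]]; rewrite subsetD1.
  rewrite setU11 andbT subUset sub1set Ax /=.
  have [Sx|Sx] := boolP (x \in S).
    rewrite andbF /= (setUidPr _) ?sub1set //.
    apply/esym/negbTE; rewrite negb_and; apply/orP; right.
    by apply/eqP => e; rewrite -e !inE eqxx in Sx.
  by rewrite setU1K // eqxx cardsU1 Sx !andbT.
by move=> /andP[_ Sx]; rewrite big_setU1.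
Qed.

Lemma elsymD1 A x k : x \in A ->
  elsym A k.+1 = elsym (A :\ x) k.+1 + y x * elsym (A :\ x) k.
Proof.
move=> Ax; rewrite mul_elsymD1 // /elsym (bigID (fun S : {set T} => x \in S)) /= addrC.
by congr (_ + _); apply: eq_bigl => S; rewrite subsetD1 andbAC.
Qed.

Lemma mulr_elsym A k : k.+1%:R * elsym A k.+1 = hook_sum A 1 k.
Proof.
rewrite /hook_sum; under eq_bigr => x Ax do rewrite expr1 mul_elsymD1 //.
rewrite (exchange_big_dep (fun S : {set T} => (S \subset A) && (#|S| == k.+1))) /=; last first.
  by move=> x S _ /andP[].
rewrite mulr_sumr; apply: eq_bigr => S SAk; case/andP: (SAk) => SA /eqP Sk.
transitivity (\sum_(x in S) \prod_(z in S) y z); first by rewrite sumr_const Sk mulr_natl.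
by apply: eq_bigl => x; rewrite SAk /= andb_idl // => /(subsetP SA).
Qed.

Lemma hook_sum0 A j : hook_sum A j 0 = psum A j.
Proof. by apply: eq_bigr => x _; rewrite elsym0 mulr1. Qed.

Lemma hook_sumS A j k :
  hook_sum A j k.+1 = psum A j * elsym A k.+1 - hook_sum A j.+1 k.
Proof.
rewrite /hook_sum /psum mulr_suml -sumrB; apply: eq_bigr => x Ax.
by rewrite (elsymD1 k Ax) mulrDr exprSr -mulrA addrK.
Qed.

(** The coefficient of t^k in (1 - t)^(-q), which solves the recurrence from Newton's identities
    with equality. *)
Definition rising_binom (q : C) k := \prod_(i < k) (q + i%:R) / k`!%:R.

Lemma rising_binomS q k : k.+1%:R * rising_binom q k.+1 = (q + k%:R) * rising_binom q k.
Proof.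
rewrite /rising_binom big_ord_recr /= factS natrM.
have k0 : k.+1%:R != 0 :> C by rewrite pnatr_eq0.
have f0 : k`!%:R != 0 :> C by rewrite pnatr_eq0 -lt0n fact_gt0.
by move: k.+1%:R k`!%:R k0 f0 => u v u0 v0; field; rewrite u0 v0.
Qed.

Lemma sum_rising_binom q k : q * (\sum_(i < k) rising_binom q i) = k%:R * rising_binom q k.
Proof.
elim: k => [|k IH]; first by rewrite big_ord0 mulr0 mul0r.
by rewrite big_ord_recr /= mulrDr IH rising_binomS mulrDl addrC.
Qed.

Lemma hook_sum_le A q n j k : (forall i, (0 < i <= n)%N -> `|psum A i| <= q) ->
  (0 < j)%N -> (j + k <= n)%N -> `|hook_sum A j k| <= q * \sum_(i < k.+1) `|elsym A i|.
Proof.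
move=> pq; elim: k j => [|k IH] j j0 jk.
  by rewrite hook_sum0 big_ord1 elsym0 normr1 mulr1 pq // j0 -(addn0 j).
rewrite hook_sumS big_ord_recr /= mulrDr [leRHS]addrC.
apply: le_trans (ler_normB _ _) _; apply: lerD.
  by rewrite normrM ler_wpM2r // pq // j0 (leq_trans (leq_addr _ _) jk).
by apply: IH; rewrite // addSnnS.
Qed.

(* Newton's identities, in the form [(k+1) e_(k+1) = p_1 e_k - p_2 e_(k-1) + ...],
   turn a bound on power sums into one on elementary symmetric functions. *)
Lemma elsym_le A q n k : 0 <= q -> (forall i, (0 < i <= n)%N -> `|psum A i| <= q) ->
  (k <= n)%N -> `|elsym A k| <= rising_binom q k.
Proof.
move=> q0 pq; elim/ltn_ind: k => -[|k] IH kn.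
  by rewrite elsym0 normr1 /rising_binom big_ord0 fact0 divr1.
have k0 : 0 < k.+1%:R :> C by rewrite ltr0n.
rewrite -(ler_pM2l k0) -[X in X * _ <= _](ger0_norm (ltW k0)) -normrM mulr_elsym.
rewrite -sum_rising_binom; apply: le_trans (@hook_sum_le A q n 1 k pq isT kn) _.
apply: ler_wpM2l => //; apply: ler_sum => i _.
by apply: IH => //; apply: leq_trans kn; apply: ltnW.
Qed.
End ElementarySymmetric.

Lemma prime_prim_root_exists (C : numClosedFieldType) (p : nat) :
  prime p -> exists w : C, p.-primitive_root w.
Proof.
move=> p_pr; have p1 := prime_gt1 p_pr.
(* A root of 1 + X + ... + X^(p-1) satisfies z^p = 1 and is not 1, so its order is the prime [p]. *)
pose q : {poly C} := \poly_(i < p) 1.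
have sq : size q = p by rewrite size_poly_eq // oner_eq0.
have [|z /rootP qz] := closed_rootP q _; first by rewrite sq gtn_eqF.
have z_neq1 : z != 1.
  apply/eqP => z1; move: qz; rewrite z1 horner_poly.
  under eq_bigr do rewrite expr1n mulr1.
  by rewrite sumr_const card_ord => /eqP; rewrite pnatr_eq0 gtn_eqF // ltnW.
have zp : z ^+ p = 1.
  apply/eqP; rewrite -subr_eq0 subrX1 (_ : \sum_(i < p) z ^+ i = 0) ?mulr0 //.
  by rewrite -[RHS]qz horner_poly; apply: eq_bigr => i _; rewrite mul1r.
have [k zk kp] := prim_order_exists (ltnW p1) zp.
exists z; move: zk; have [_ /(_ k kp)/orP[/eqP ->|/eqP -> //]] := primeP p_pr.
by move=> /prim_expr_order; rewrite expr1 => /eqP; rewrite (negbTE z_neq1).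
Qed.

(** * Counting subsets *)

Section SubsetSums.
Variables (C : numClosedFieldType) (p : nat) (w : C) (m : nat).
Hypotheses (p_pr : prime p) (w_prim : p.-primitive_root w).

Lemma Nstar_fourier k (b : 'F_p) : p%:R * (Nstar m k b)%:R =
  \sum_a addchar w (- (a * b)) * elsym (fun x => addchar w (a * x ^+ m)) [set~ 0] k.
Proof.
pose good (S : {set 'F_p}) := (S \subset [set~ 0]) && (#|S| == k).
transitivity (\sum_(S | good S) \sum_a addchar w (a * (\sum_(x in S) x ^+ m - b))).
  under [RHS]eq_bigr do rewrite (sum_addchar p_pr w_prim) subr_eq0.
  rewrite -big_mkcondr sumr_const mulr_natr /Nstar cardsE; congr (_ *+ _).
  by apply: eq_card => S; rewrite !unfold_in /good andbA.
rewrite exchange_big; apply: eq_bigr => a _; rewrite mulr_sumr; apply: eq_bigr => S _.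
by rewrite -(addchar_sum p_pr w_prim) -(addcharD p_pr w_prim) mulrBr mulr_sumr addrC.
Qed.

Lemma Nstar_bound k (b : 'F_p) (q : C) : 0 <= q -> (k < p)%N ->
  (forall a : 'F_p, a != 0 -> `|gauss_sum w m a| <= q) ->
  `|(Nstar m k b)%:R - p%:R^-1 * 'C(p.-1, k)%:R| <= rising_binom q k.
Proof.
move=> q0 kp le_q; have p0 : 0 < p%:R :> C by rewrite ltr0n prime_gt0.
have elsym_triv : elsym (fun x : 'F_p => addchar w (0 * x ^+ m)) [set~ 0] k = 'C(p.-1, k)%:R.
  rewrite /elsym -(card_nonzero p_pr) -cards_draws -sum1dep_card natr_sum.
  by apply: eq_bigr => S _; rewrite big1 // => x _; rewrite mul0r addchar0.
have b0 : 0 <= rising_binom q k.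
  by rewrite mulr_ge0 ?invr_ge0 ?ler0n // prodr_ge0 // => i _; rewrite addr_ge0 ?ler0n.
have elsym_small (a : 'F_p) : a != 0 ->
    `|elsym (fun x : 'F_p => addchar w (a * x ^+ m)) [set~ 0] k| <= rising_binom q k.
  move=> a0; apply: (@elsym_le _ _ _ _ _ k) => // i /andP[i0 ik].
  (* The i-th power sum of the values e(a x^m) is the Gauss sum at i a, a nonzero frequency because
     0 < i <= k < p. *)
  apply: le_trans (le_q (i%:R * a) _); last first.
    by rewrite mulf_neq0 // -(dvdn_pcharf (pchar_Fp p_pr)) gtnNdvd // (leq_ltn_trans ik).
  rewrite le_eqVlt; apply/orP; left; apply/eqP; congr `|_|.
  by apply: eq_bigr => x _; rewrite (addchar_exp p_pr w_prim) mulrA.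
rewrite -(ler_pM2l p0) -[X in X * `|_|](ger0_norm (ltW p0)) -normrM mulrBr mulVKf ?gt_eqF //.
rewrite Nstar_fourier (bigD1 0) //= elsym_triv mul0r oppr0 addchar0 mul1r addrAC subrr add0r.
apply: le_trans (ler_norm_sum _ _ _) _.
apply: le_trans (_ : \sum_(a : 'F_p | a != 0) rising_binom q k <= _).
  by apply: ler_sum => a a0; rewrite normrM (addchar_norm p_pr w_prim) mul1r elsym_small.
rewrite sumr_const -[leLHS]mulr_natl ler_wpM2r // ler_nat.
by rewrite (leq_trans (max_card _)) // card_Fp.
Qed.
End SubsetSums.

(** * Passage to real exponents and the final estimate *)

Lemma norm_real_complex (R : realType) (x : R) : `|(x%:C)%C| = (`|x|%:C)%C.
Proof.
have [x0|x0] := ger0P x; first by rewrite ger0_norm // lecR.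
by rewrite ler0_norm ?lecR ?ltW // rmorphN.
Qed.

(** [M] is the integer part of the R-th root of [p]; as M^2 > M, maximality gives the upper
    bound. *)
Lemma integer_root_exists (R p : nat) : (0 < R)%N -> (2 ^ R <= p)%N ->
  exists2 M : nat, (1 < M)%N & (M ^ R <= p < M ^ (2 * R))%N.
Proof.
move=> R0 p2; have ex : exists M, (M ^ R <= p)%N by exists 2%N.
have bnd M : (M ^ R <= p)%N -> (M <= p)%N.
  by apply: leq_trans; case: M => // M; rewrite -[leqLHS]expn1 leq_pexp2l.
have := ex_maxnP ex bnd; case: ex_maxnP => M Mp maxM _; exists M; first exact: maxM.
have M1 := maxM 2%N p2; rewrite Mp /= expnM ltnNge; apply/negP => Mp2.
by have := maxM _ Mp2; rewrite leqNgt -mulnn ltn_Pmull // ltnW.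
Qed.

Lemma gauss_sum_power_saving (R : realType) (delta : R) : 0 < delta -> delta < 1 ->
  exists epsilon : R, 0 < epsilon /\ epsilon < delta /\
    forall (p m : nat) (w : R[i]) (a : 'F_p), prime p -> p.-primitive_root w ->
      (0 < m)%N -> m%:R < p%:R `^ (1 - delta) -> a != 0 ->
      `|gauss_sum w m a| <= ((p%:R `^ (1 - epsilon))%:C)%C.
Proof.
move=> d0 d1; pose D := (Num.trunc delta^-1).+1.
have dD : 1 <= delta * D%:R by rewrite -ler_pdivrMl // mulr1 ltW // truncnS_gt.
have [Rt [Rt0 bound]] := gauss_sum_bound (isT : (0 < D)%N).
(* The three terms ensure in turn eps < delta, p^eps <= M when p >= 2^Rt, and eps p^2 <= 1 for
   smaller [p]. *)
pose eps := Num.min (delta / 2) (Num.min (2 * Rt%:R)^-1 (2 ^- Rt ^+ 2)).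
have eps0 : 0 < eps.
  by rewrite !lt_min divr_gt0 ?invr_gt0 ?mulr_gt0 ?ltr0n ?exprn_gt0 //.
exists eps; split=> //; split.
  by rewrite gt_min; apply/orP; left; rewrite ltr_pdivrMr // ltr_pMr // ltr1n.
move=> p m w a p_pr w_prim m0 mp a0; have p1 := prime_gt1 p_pr.
have p0 : 0 < p%:R :> R by rewrite ltr0n ltnW.
have p1R : 1 <= p%:R :> R by rewrite ler1n ltnW.
have mD : (m ^ D < p ^ D.-1)%N.
  rewrite -(ltr_nat R) !natrX; apply: (@lt_le_trans _ _ ((p%:R `^ (1 - delta)) ^+ D)).
    by rewrite ltrXn2r // ?nnegrE ?powR_ge0.
  rewrite -powR_mulrn ?powR_ge0 // -powRrM -powR_mulrn ?ler0n //.
  apply: ler_powR => //; rewrite mulrBl mul1r (_ : D%:R = D.-1%:R + 1 :> R) ?natr1 //.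
  by move: (delta * _) dD => x; lra.
have [p2|p2] := leqP (2 ^ Rt) p.
  have [M M1 Mp] := integer_root_exists Rt0 p2.
  have M0 : 0 < M%:R :> R by rewrite ltr0n ltnW.
  have M0C : 0 < M%:R :> R[i] by rewrite ltr0n ltnW.
  have := bound _ p w m M a p_pr w_prim m0 mD M1 Mp a0.
  rewrite -ltr_pdivlMr // => /ltW/le_trans; apply.
  rewrite -!(rmorph_nat (real_complex R)) -fmorphV -rmorphM lecR.
  rewrite ler_pdivrMr //; apply: (@le_trans _ _ p%:R); first by rewrite ler_nat leq_pred.
  rewrite -[leLHS]powRr1 ?(ltW p0) // -[X in _ `^ X](subrK eps) powRD; last by rewrite (gt_eqF p0) implybT.
  apply: ler_wpM2l; first exact: powR_ge0.
  apply: (@le_trans _ _ (p%:R `^ ((2 * Rt)%:R^-1))).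
    by apply: ler_powR; rewrite // natrM /eps !ge_min lexx !orbT.
  have R0 : (2 * Rt)%:R != 0 :> R by rewrite pnatr_eq0 -lt0n muln_gt0.
  rewrite -[leRHS]powRr1 ?(ltW M0) // -[X in _ <= _ `^ X](divff R0) powRrM.
  apply: ge0_ler_powR; rewrite ?invr_ge0 ?ler0n ?nnegrE ?powR_ge0 ?(ltW p0) //.
  by rewrite powR_mulrn ?(ltW M0) // -natrX ler_nat; case/andP: Mp => _ /ltnW.
(* For small [p] the trivial bound suffices: p^(-eps) >= 1 - eps p >= 1 - 1/p. *)
apply: le_trans (@gauss_sum_le _ _ _ m p_pr w_prim a) _.
rewrite -(rmorph_nat (real_complex R)) lecR powRD ?(gt_eqF p0) ?implybT // powRr1 ?(ltW p0) //.
have -> : p.-1%:R = p%:R - 1 :> R by rewrite -[in RHS](prednK (ltnW p1)) -natr1 addrK.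
have ln_le : 1 - eps * p%:R <= p%:R `^ (- eps).
  rewrite /powR (gt_eqF p0); apply: le_trans (expR_ge1Dx _).
  by rewrite lerD2l mulNr lerN2 ler_wpM2l ?(ltW eps0) // (ltW (ln_sublinear p0)).
apply: le_trans (ler_wpM2l (ltW p0) ln_le); rewrite mulrBr mulr1 lerD2l lerN2.
apply: (@le_trans _ _ (2 ^+ Rt * ((2 ^- Rt) ^+ 2 * 2 ^+ Rt))).
  have p2R : p%:R <= 2 ^+ Rt :> R by rewrite -natrX ler_nat ltnW.
  apply: (ler_pM (ltW p0) (mulr_ge0 (ltW eps0) (ltW p0)) p2R).
  apply: (ler_pM (ltW eps0) (ltW p0) _ p2R).
  by rewrite /eps !ge_min lexx !orbT.
by rewrite expr2 !mulrA divff ?mul1r ?mulVf // expf_neq0 // pnatr_eq0.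
Qed.

Theorem theorem1p1 (R : realType) (delta : R)
    (hdelta0 : 0 < delta) (hdelta1 : delta < 1) :
  exists epsilon : R, 0 < epsilon /\ epsilon < delta /\
    forall (p m k : nat) (b : 'F_p),
      prime p -> odd p -> (0 < m)%N -> m%:R < p%:R `^ (1 - delta) ->
      `|(Nstar m k b)%:R - p%:R^-1 * 'C(p.-1, k)%:R|
        <= rbinom (p%:R `^ (1 - epsilon) + m%:R * k%:R - m%:R) k.
Proof.
have [eps [eps0 [epsd bound]]] := gauss_sum_power_saving hdelta0 hdelta1.
exists eps; split=> //; split=> // p m k b p_pr _ m0 mp.
set q := p%:R `^ (1 - eps).
have q0 : 0 <= q by apply: powR_ge0.
have prod_ge0 : 0 <= \prod_(i < k) (q + i%:R).
  by apply: prodr_ge0 => i _; rewrite addr_ge0.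
(* After reversing the order of the falling factors, compare factor by factor: m (k-1) >= k-1
   because m >= 1. *)
have rbinom_ge : \prod_(i < k) (q + i%:R) / k`!%:R <= rbinom (q + m%:R * k%:R - m%:R) k.
  rewrite /rbinom ler_wpM2r ?invr_ge0 ?ler0n // /falling (reindex_inj rev_ord_inj) /=.
  apply: ler_prod => i _; rewrite addr_ge0 ?ler0n //= -!addrA lerD2l.
  rewrite addrA !lerBrDr -!natrM -!natrD ler_nat.
  have := ltn_ord i; move: (val i) => j jk; nia.
(* For k >= p there are no such subsets and the binomial coefficient vanishes. *)
have [kp|pk] := ltnP k p; last first.
  have -> : Nstar m k b = 0%N.
    apply/eqP; rewrite cards_eq0; apply/eqP/setP => S.
    rewrite !inE; apply/negP => /and3P[S0 /eqP Sk _]; have := subset_leq_card S0.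
    by rewrite Sk card_nonzero // leqNgt prednK ?prime_gt0 // pk.
  rewrite bin_small ?prednK ?prime_gt0 // mulr0 subr0 normr0.
  by apply: le_trans rbinom_ge; rewrite mulr_ge0 ?invr_ge0.
apply: le_trans rbinom_ge; have [w w_prim] := prime_prim_root_exists R[i] p_pr.
have q0C : 0 <= (q%:C)%C by rewrite lecR.
have := @Nstar_bound _ p w m p_pr w_prim k b _ q0C kp (fun a => bound p m w a p_pr w_prim m0 mp).
rewrite -lecR -norm_real_complex /rising_binom.
rewrite !(rmorphB, rmorphM, fmorphV, rmorph_nat, rmorph_prod) /=.
under [X in _ -> _ <= X * _]eq_bigr do rewrite rmorphD rmorph_nat.
by apply.
Qed.
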